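(* Let $\mathcal{M}$ be a smooth connected manifold. Then the closure of $\mathrm{Met}_{C^\infty}(\mathcal{M})$ in $(\mathrm{Met}(\mathcal{M}),\mathbb{d}^{\mathcal{M}})$ satisfies $$\overline{\mathrm{Met}_{C^\infty}(\mathcal{M})}^{\,\mathbb{d}^{\mathcal{M}}}=\mathrm{Met}_{C^0}(\mathcal{M}).$$ In particular, $\mathrm{Met}_{C^0}(\mathcal{M})$ is a closed and, hence, a complete subset of $(\mathrm{Met}(\mathcal{M}),\mathbb{d}^{\mathcal{M}})$.
   Context: $\mathcal{M}$ carries a smooth differentiable structure and has no boundary. A set $Z\subset\mathcal{M}$ has measure zero if its image in every smooth chart has Lebesgue measure zero; ''almost every'' (a.e.) refers to this notion. A rough Riemannian metric on $\mathcal{M}$ is a measurable symmetric $(2,0)$-tensor field $\mathrm{g}$ (a measurable section of symmetric bilinear forms on $T\mathcal{M}$; fields agreeing a.e. are identified) such that for every $x\in\mathcal{M}$ there is a chart $(U,\psi)$ near $x$ and a constant $C_U\ge 1$ with $C_U^{-1}|u|_{\psi^*\delta(y)}\le |u|_{\mathrm{g}(y)}\le C_U|u|_{\psi^*\delta(y)}$ for almost every $y\in U$ and all $u\in T_yU$. Here $|u|_{\mathrm{g}(y)}=\sqrt{\mathrm{g}(y)[u,u]}$ and $\delta$ is the Euclidean metric. $\mathrm{Met}(\mathcal{M})$ is the set of all rough Riemannian metrics on $\mathcal{M}$. $\mathrm{Met}_{C^\infty}(\mathcal{M})$ and $\mathrm{Met}_{C^0}(\mathcal{M})$ denote the subsets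 of smooth, respectively continuous, Riemannian metrics on $\mathcal{M}$. For $C\ge1$, write $\mathrm{g}\sim_C\mathrm{h}$ if $C^{-1}|u|_{\mathrm{h}(x)}\le|u|_{\mathrm{g}(x)}\le C|u|_{\mathrm{h}(x)}$ for almost every $x\in\mathcal{M}$ and all $u\in T_x\mathcal{M}$. The extended metric $\mathbb{d}^{\mathcal{M}}$ on $\mathrm{Met}(\mathcal{M})$ is $\mathbb{d}^{\mathcal{M}}(\mathrm{g},\mathrm{h})=\inf\{\log C: C\ge 1,\ \mathrm{g}\sim_C\mathrm{h}\}$ if some such $C$ exists, and $+\infty$ otherwise. Complete means that every Cauchy sequence in the subset converges to an element of the subset. *)

(* Defs.v *)
From HB Require Import structures.
From mathcomp Require Import all_boot all_order all_algebra.
From mathcomp Require Import all_classical all_reals all_analysis.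
Set Implicit Arguments.
Unset Strict Implicit.
Unset Printing Implicit Defensive.
Import Order.TTheory GRing.Theory Num.Theory.
Import numFieldNormedType.Exports.
Local Open Scope classical_set_scope.
Local Open Scope ring_scope.
Local Open Scope quotient_scope.

Section Euclidean.
Context {R : realType}.

(* f is C^k on the open set U; only the germs of f at points of U matter. *)
Fixpoint Ck_on {V W : normedModType R} (k : nat) (U : set V) (f : V -> W) :
    Prop :=
  if k is k'.+1 then
    (forall x, U x -> differentiable f x) /\
    (forall v : V, Ck_on k' U ('D_v f))
  else forall x, U x -> {for x, continuous f}.

Definition smooth_on {V W : normedModType R} (U : set V) (f : V -> W) : Prop :=
  forall k, Ck_on k U f.

Context {n : nat}.
Implicit Types (a b : 'rV[R]_n) (Z : set 'rV[R]_n).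

Definition box a b : set 'rV[R]_n :=
  [set x | forall i, a ord0 i <= x ord0 i <= b ord0 i].

Definition box_volume a b : R := \prod_(i < n) (b ord0 i - a ord0 i).

(* Lebesgue null sets: covered by countably many boxes of arbitrarily small
   total volume.  The index set D allows finite (or empty) covers, which
   matters only for n = 0, where every box has volume 1. *)
Definition null_set Z : Prop :=
  forall e : R, 0 < e -> exists (D : set nat) (a b : nat -> 'rV[R]_n),
    [/\ forall k, D k -> forall i, a k ord0 i <= b k ord0 i,
        Z `<=` \bigcup_(k in D) box (a k) (b k) &
        (\esum_(k in D) (box_volume (a k) (b k))%:E <= e%:E)%E].

(* The completion of the Borel sigma-algebra of R^n. *)
Definition lebesgue_measurable Z : Prop :=
  exists2 B, <<s [set U : set 'rV[R]_n | open U] >> B & null_set (Z `+` B).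

Definition lebesgue_measurable_fun (D : set 'rV[R]_n) (f : 'rV[R]_n -> R) :
    Prop :=
  forall B : set R, measurable B -> lebesgue_measurable (D `&` f @^-1` B).

Lemma null_setS Y Z : Y `<=` Z -> null_set Z -> null_set Y.
Proof.
move=> YZ nZ e e0; have [D [a [b [ab ZD De]]]] := nZ e e0.
by exists D, a, b; split=> //; exact: subset_trans ZD.
Qed.

Lemma null_set0 : null_set set0.
Proof.
move=> e e0; exists set0, (fun=> 0), (fun=> 0); split=> //.
by rewrite esum_set0 lee_fin ltW.
Qed.

Lemma null_setU Y Z : null_set Y -> null_set Z -> null_set (Y `|` Z).
Proof.
move=> nY nZ e e0; have e20 : 0 < e / 2 by rewrite divr_gt0.
have [D1 [a1 [b1 [ab1 ZD1 De1]]]] := nY _ e20.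
have [D2 [a2 [b2 [ab2 ZD2 De2]]]] := nZ _ e20.
pose sel T (u v : nat -> T) k := if odd k then v k./2 else u k./2.
have selE T (u v : nat -> T) k : sel T u v k.*2 = u k.
  by rewrite /sel odd_double doubleK.
have selO T (u v : nat -> T) k : sel T u v k.*2.+1 = v k.
  by rewrite /sel /= odd_double /= uphalf_double.
exists (sel _ D1 D2), (sel _ a1 a2), (sel _ b1 b2).
have ab k : sel _ D1 D2 k -> forall i, sel _ a1 a2 k ord0 i <= sel _ b1 b2 k ord0 i.
  by rewrite /sel; case: ifP => _; [exact: ab2|exact: ab1].
split=> //.
  move=> x [/ZD1|/ZD2] [k Dk xk].
    by exists k.*2; rewrite ?selE.
  by exists k.*2.+1; rewrite ?selO.
have vol0 k : sel _ D1 D2 k ->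
    (0 <= (box_volume (sel _ a1 a2 k) (sel _ b1 b2 k))%:E)%E.
  move=> Dk; rewrite lee_fin; apply: prodr_ge0 => i _.
  by rewrite subr_ge0; exact: ab.
have DE : sel _ D1 D2 = double @` D1 `|` (fun k => k.*2.+1) @` D2.
  apply/seteqP; split=> [k|k [[j Dj <-]|[j Dj <-]]]; last 2 first.
  - by rewrite selE.
  - by rewrite selO.
  rewrite /sel; case: ifP => ok Dk; [right|left]; exists k./2 => //;
    by rewrite -[RHS](odd_double_half k) ok.
rewrite (esumID (double @` D1)) //.
have -> : sel _ D1 D2 `&` double @` D1 = double @` D1.
  by rewrite DE; apply/setIidPr => x ?; left.
have -> : sel _ D1 D2 `&` ~` (double @` D1) = (fun k => k.*2.+1) @` D2.
  rewrite DE; apply/seteqP; split=> [k [[//|//]]|k Dk].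
  split; first by right.
  case: Dk => j _ <- [i _] /(congr1 odd) /=.
  by rewrite !odd_double.
rewrite esum_image; last by move=> i j _ _; exact: double_inj.
rewrite esum_image; last by move=> i j _ _ [] /double_inj.
under eq_esum do rewrite !selE.
under [X in (_ + X)%E]eq_esum do rewrite !selO.
by rewrite (splitr e) EFinD; exact: leeD.
Qed.

End Euclidean.

Section Manifold.
Context {R : realType} {n : nat} {M : topologicalType}.

(* A chart is a homeomorphism, with inverse [bwd], from the open set [dom]
   onto an open subset of R^n; outside [dom], resp. [codom], the values of
   [fwd], resp. [bwd], are irrelevant. *)
Record chart := Chart {
  dom : set M;
  fwd : M -> 'rV[R]_n;
  bwd : 'rV[R]_n -> M;
  open_dom : open dom;
  open_codom : open (fwd @` dom);
  fwdK : forall x, dom x -> bwd (fwd x) = x;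
  fwd_continuous : {within dom, continuous fwd};
  bwd_continuous : {within fwd @` dom, continuous bwd} }.

Definition codom (c : chart) : set 'rV[R]_n := fwd c @` dom c.

Definition transition (c d : chart) : 'rV[R]_n -> 'rV[R]_n := fwd d \o bwd c.

Definition compatible (c d : chart) : Prop :=
  smooth_on (fwd c @` (dom c `&` dom d)) (transition c d) /\
  smooth_on (fwd d @` (dom d `&` dom c)) (transition d c).

Record smooth_structure := SmoothStructure {
  atlas : set chart;
  atlas_cover : forall x, exists2 c, atlas c & dom c x;
  atlas_compatible : forall c d, atlas c -> atlas d -> compatible c d;
  atlas_maximal :
    forall c, (forall d, atlas d -> compatible c d) -> atlas c }.

Variable A : smooth_structure.

Definition chart_at (x : M) : set chart := [set c | atlas A c /\ dom c x].

(* A tangent vector at x is a family of coordinate vectors, one for each chart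
   of the atlas at x, related by the differentials of the transition maps; it
   is extended by 0 to the other charts, so that equality is meaningful. *)
Definition tangent_family (x : M) : {pred chart -> 'rV[R]_n} :=
  fun u => `[< (forall c, ~ chart_at x c -> u c = 0) /\
    forall c d, chart_at x c -> chart_at x d ->
      u d = 'd (transition c d) (fwd c x) (u c) >].

Lemma tangent_family_submod x : submod_closed (tangent_family x).
Proof.
split=> [|a u v /asboolP[u0 uE] /asboolP[v0 vE]]; apply/asboolP; split=> //.
- by move=> c d _ _; rewrite linear0.
- by move=> c cx; rewrite /GRing.add /= /GRing.scale /= u0 ?v0// scaler0 addr0.
- move=> c d cx dx; rewrite /GRing.add /= /GRing.scale /=.
  by rewrite linearP (uE c d) ?(vE c d).
Qed.

HB.instance Definition _ x := GRing.isSubmodClosed.Build R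
  (chart -> 'rV[R]_n) (tangent_family x) (tangent_family_submod x).

Record tangent (x : M) := Tangent {
  tangent_val : chart -> 'rV[R]_n;
  tangent_valP : tangent_val \in tangent_family x }.

HB.instance Definition _ x := [isSub for @tangent_val x].
HB.instance Definition _ x := [Choice of tangent x by <:].
HB.instance Definition _ x := [SubChoice_isSubLmodule of tangent x by <:].

Definition coord (x : M) (c : chart) (u : tangent x) : 'rV[R]_n :=
  tangent_val u c.

Lemma open_overlap (c d : chart) : open (fwd c @` (dom c `&` dom d)).
Proof.
have -> : fwd c @` (dom c `&` dom d) = codom c `&` bwd c @^-1` dom d.
  apply/seteqP; split=> [_ [x [cx dx] <-]|_ [[x cx <-]]] /=.
    by split; [exists x|rewrite /= fwdK].
  by rewrite fwdK// => dx; exists x.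
have oc := @open_codom c.
have := @bwd_continuous c; rewrite continuous_open_subspace// continuous_inP//.
by apply; exact: open_dom.
Qed.

Lemma near_overlap (c d : chart) x : dom c x -> dom d x ->
  \forall y \near fwd c x, (fwd c @` (dom c `&` dom d)) y.
Proof.
move=> cx dx; apply: open_nbhs_nbhs; split; first exact: open_overlap.
by exists x.
Qed.

Lemma transition_differentiable (c d : chart) x :
  chart_at x c -> chart_at x d -> differentiable (transition c d) (fwd c x).
Proof.
move=> [Ac cx] [Ad dx]; have [+ _] := atlas_compatible Ac Ad.
by move=> /(_ 1) [+ _]; apply; exists x.
Qed.

Lemma diff_transition_comp (c d e : chart) x v :
    chart_at x c -> chart_at x d -> chart_at x e ->
  'd (transition c e) (fwd c x) v =
  'd (transition d e) (fwd d x) ('d (transition c d) (fwd c x) v).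
Proof.
move=> cx dx ex.
have cd := transition_differentiable cx dx.
have de : differentiable (transition d e) (transition c d (fwd c x)).
  rewrite /transition /= fwdK; last exact: cx.2.
  exact: transition_differentiable.
have fE : transition c d (fwd c x) = fwd d x.
  by rewrite /transition /= fwdK//; exact: cx.2.
apply: etrans (esym (deriveE v (transition_differentiable cx ex))) _.
have comp : 'D_v (transition d e \o transition c d) (fwd c x) =
    'd (transition d e) (fwd d x) ('d (transition c d) (fwd c x) v).
  rewrite deriveE; last exact: differentiable_comp.
  apply: etrans (congr1 (fun f => f v) (diff_comp cd de)) _.
  by move: fE => /= ->.
apply: etrans comp.
apply: near_eq_derive.
near=> y.
have : (fwd c @` (dom c `&` dom d)) y.
  by near: y; apply: near_overlap; [exact: cx.2|exact: dx.2].
by move=> [z [cz dz] <-]; rewrite /transition /= fwdK// fwdK.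
Unshelve. all: by end_near. Qed.

Lemma diff_transition_id (c : chart) x v :
  chart_at x c -> 'd (transition c c) (fwd c x) v = v.
Proof.
move=> cx; rewrite -deriveE; last exact: transition_differentiable.
rewrite (@near_eq_derive _ _ _ _ id) ?derive_id//.
near=> y.
have : (fwd c @` (dom c `&` dom c)) y.
  by near: y; apply: near_overlap; exact: cx.2.
by move=> [z [cz _] <-]; rewrite /transition /= fwdK.
Unshelve. all: by end_near. Qed.

Lemma tangent_of_subproof (c : chart) (x : M) (v : 'rV[R]_n) :
  (fun d => if `[< chart_at x c /\ chart_at x d >]
            then 'd (transition c d) (fwd c x) v else 0) \in tangent_family x.
Proof.
apply/asboolP; split=> [d dx|d e dx ex]; first by case: asboolP => // -[].
case: (pselect (chart_at x c)) => cx; last first.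
  by do 2 (case: asboolP => [[]//|_]); rewrite linear0.
by do 2 (case: asboolP => [_|/not_andP[]//]); exact: diff_transition_comp.
Qed.

(* The tangent vector at x with coordinates v in the chart c (0 if c is not a
   chart at x). *)
Definition tangent_of (c : chart) (x : M) (v : 'rV[R]_n) : tangent x :=
  Tangent (tangent_of_subproof c x v).

Lemma tangent_ofK (c : chart) x : chart_at x c ->
  cancel (tangent_of c x) (@coord x c).
Proof.
move=> cx v; rewrite /coord /=; case: asboolP => [_|[]//].
exact: diff_transition_id.
Qed.

Lemma coordK (c : chart) x : chart_at x c ->
  cancel (@coord x c) (tangent_of c x).
Proof.
move=> cx u; apply: val_inj; apply/funext => d /=.
have /asboolP[u0 uE] := tangent_valP u.
case: asboolP => [[_ dx]|ndx]; first by rewrite -uE.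
by rewrite [RHS]u0// => dx; apply: ndx.
Qed.

Definition measure_zero (Z : set M) : Prop :=
  forall c, atlas A c -> null_set (fwd c @` (Z `&` dom c)).

Definition almost_everywhere (P : M -> Prop) : Prop :=
  measure_zero [set x | ~ P x].

Lemma aeT (P : M -> Prop) : (forall x, P x) -> almost_everywhere P.
Proof.
move=> PT c _; apply: null_setS null_set0 => _ [x [nPx _] <-]; case: nPx; exact: PT.
Qed.

Lemma ae_and (P Q S : M -> Prop) : (forall x, P x -> Q x -> S x) ->
  almost_everywhere P -> almost_everywhere Q -> almost_everywhere S.
Proof.
move=> PQS aeP aeQ c Ac; apply: null_setS (null_setU (aeP c Ac) (aeQ c Ac)).
move=> _ [x [nSx cx] <-]; have [Px|nPx] := pselect (P x); last first.
  by left; exists x.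
by right; exists x => //; split=> // Qx; apply/nSx/PQS.
Qed.

Definition tensor_field := forall x : M, {symmetric (tangent x)}.

Implicit Types g h : tensor_field.

Definition tnorm g (x : M) (u : tangent x) : R := Num.sqrt (g x u u).

(* The Euclidean metric pulled back by the chart c. *)
Definition pullback_norm (c : chart) (x : M) (u : tangent x) : R :=
  Num.sqrt (\sum_(i < n) coord c u ord0 i ^+ 2).

(* The component g_ij of g in the chart c, as a function on [codom c]. *)
Definition component g (c : chart) (i j : 'I_n) (y : 'rV[R]_n) : R :=
  g (bwd c y) (tangent_of c (bwd c y) (delta_mx ord0 i))
              (tangent_of c (bwd c y) (delta_mx ord0 j)).

Definition measurable_field g : Prop :=
  forall c i j, atlas A c ->
    lebesgue_measurable_fun (codom c) (component g c i j).

Definition rough_metric_axiom g : Prop :=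
  measurable_field g /\
  forall x, exists c, chart_at x c /\ exists2 C : R, 1 <= C &
    almost_everywhere (fun y => dom c y -> forall u : tangent y,
      C^-1 * pullback_norm c u <= tnorm g u <= C * pullback_norm c u).

Definition positive_definite g : Prop :=
  forall x (u : tangent x), u != 0 -> 0 < g x u u.

Definition continuous_metric g : Prop :=
  positive_definite g /\
  forall c i j, atlas A c -> {within codom c, continuous (component g c i j)}.

Definition smooth_metric g : Prop :=
  positive_definite g /\
  forall c i j, atlas A c -> smooth_on (codom c) (component g c i j).

Record rough_metric := RoughMetric {
  rough_field :> tensor_field;
  rough_metricP : rough_metric_axiom rough_field }.

HB.instance Definition _ := gen_eqMixin rough_metric.
HB.instance Definition _ := gen_choiceMixin rough_metric.

Definition ae_equal (g h : rough_metric) : bool :=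
  `[< almost_everywhere (fun x => forall u v : tangent x,
        rough_field g x u v = rough_field h x u v) >].

Lemma ae_equal_refl : reflexive ae_equal.
Proof. by move=> g; apply/asboolP/aeT. Qed.

Lemma ae_equal_sym : symmetric ae_equal.
Proof.
suff sub (g h : rough_metric) : ae_equal g h -> ae_equal h g.
  by move=> g h; apply/idP/idP; exact: sub.
by move=> /asboolP gh; apply/asboolP; apply: ae_and (gh) (gh) => x ghx _ u v.
Qed.

Lemma ae_equal_trans : transitive ae_equal.
Proof.
move=> h g k /asboolP gh /asboolP hk; apply/asboolP.
by apply: ae_and gh hk => x ghx hkx u v; rewrite ghx.
Qed.

Canonical ae_equal_equiv :=
  EquivRel ae_equal ae_equal_refl ae_equal_sym ae_equal_trans.

Definition Met := {eq_quot ae_equal}.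
HB.instance Definition _ := Choice.on Met.
HB.instance Definition _ := EqQuotient.on Met.

(* g ~_C h *)
Definition sim_metric (C : R) g h : Prop :=
  almost_everywhere (fun x => forall u : tangent x,
    C^-1 * tnorm h u <= tnorm g u <= C * tnorm h u).

(* The infimum of the empty set is +oo. *)
Definition rough_dist g h : \bar R :=
  ereal_inf [set (ln C)%:E | C in [set C | 1 <= C /\ sim_metric C g h]].

Lemma sim_metric_refl g : sim_metric 1 g g.
Proof. by apply: aeT => x u; rewrite invr1 mul1r lexx. Qed.

Lemma sim_metric_sym C g h : 1 <= C -> sim_metric C g h -> sim_metric C h g.
Proof.
move=> C1 gh; have C0 : 0 < C by rewrite (lt_le_trans _ C1).
apply: ae_and (gh) (gh) => x ghx _ u; have /andP[lo up] := ghx u.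
by rewrite ler_pdivrMl// up mulrC -ler_pdivrMr// mulrC.
Qed.

Lemma sim_metric_trans C D g h k : 1 <= C -> 1 <= D ->
  sim_metric C g h -> sim_metric D h k -> sim_metric (C * D) g k.
Proof.
move=> C1 D1 gh hk; have C0 : 0 < C by rewrite (lt_le_trans _ C1).
have D0 : 0 < D by rewrite (lt_le_trans _ D1).
apply: ae_and gh hk => x ghx hkx u.
have /andP[lo1 up1] := ghx u; have /andP[lo2 up2] := hkx u.
apply/andP; split; last by rewrite (le_trans up1)// -mulrA ler_pM2l.
by rewrite invfM -mulrA (le_trans _ lo1)// ler_pM2l// invr_gt0.
Qed.

Lemma rough_dist_ge0 g h : (0 <= rough_dist g h)%E.
Proof.
by apply: le_ereal_inf_tmp => _ [C [C1 _] <-]; rewrite lee_fin ln_ge0.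
Qed.

Lemma rough_dist_refl g : rough_dist g g = 0%E.
Proof.
apply/eqP; rewrite eq_le rough_dist_ge0 andbT.
by apply: ereal_inf_lbound; exists 1; rewrite ?ln1//; split=> //;
  exact: sim_metric_refl.
Qed.

Lemma rough_dist_sym g h : rough_dist g h = rough_dist h g.
Proof.
suff sub g' h' : (rough_dist g' h' <= rough_dist h' g')%E.
  by apply/eqP; rewrite eq_le !sub.
apply: le_ereal_inf_tmp => _ [C [C1 gh] <-]; apply: ereal_inf_lbound.
by exists C => //; split=> //; exact: sim_metric_sym.
Qed.

Lemma rough_dist_triangle h g k :
  (rough_dist g k <= rough_dist g h + rough_dist h k)%E.
Proof.
have [->|gh_fin] := eqVneq (rough_dist g h) +oo%E.
  by rewrite addye ?leey// gt_eqF// (lt_le_trans _ (rough_dist_ge0 _ _)).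
have [->|hk_fin] := eqVneq (rough_dist h k) +oo%E.
  by rewrite addey ?leey// gt_eqF// (lt_le_trans _ (rough_dist_ge0 _ _)).
apply/lee_addgt0Pr => e e0; have e20 : 0 < e / 2 by rewrite divr_gt0.
have fin g' h' : rough_dist g' h' != +oo%E -> rough_dist g' h' \is a fin_num.
  by move=> ?; rewrite ge0_fin_numE ?ltey// rough_dist_ge0.
have [_ [C [C1 gh] <-] Ce] := lb_ereal_inf_adherent e20 (fin _ _ gh_fin).
have [_ [D [D1 hk] <-] De] := lb_ereal_inf_adherent e20 (fin _ _ hk_fin).
have C0 : 0 < C by rewrite (lt_le_trans _ C1).
have D0 : 0 < D by rewrite (lt_le_trans _ D1).
apply: (@le_trans _ _ (ln (C * D))%:E).
  apply: ereal_inf_lbound; exists (C * D) => //; split.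
    by rewrite mulr_ege1.
  exact: sim_metric_trans gh hk.
rewrite lnM ?posrE// EFinD (splitr e) EFinD addeACA.
by apply: leeD; exact: ltW.
Qed.

Lemma rough_dist_ae_equal (g h : rough_metric) : ae_equal g h ->
  rough_dist g h = 0%E.
Proof.
move=> /asboolP gh; apply/eqP; rewrite eq_le rough_dist_ge0 andbT.
apply: ereal_inf_lbound; exists 1; rewrite ?ln1//; split=> //.
by apply: ae_and (gh) (gh) => x ghx _ u; rewrite invr1 mul1r /tnorm ghx lexx.
Qed.

(* The extended metric on Met, see [Met_distE]. *)
Definition Met_dist (G H : Met) : \bar R := rough_dist (repr G) (repr H).

Lemma Met_distE (g h : rough_metric) :
  Met_dist (\pi_Met g) (\pi_Met h) = rough_dist g h.
Proof.
suff sub (g1 g2 h1 h2 : rough_metric) : ae_equal g1 g2 -> ae_equal h1 h2 ->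
    (rough_dist g1 h1 <= rough_dist g2 h2)%E.
  have rg : ae_equal (repr (\pi_Met g)) g by apply/eqmodP; rewrite reprK.
  have rh : ae_equal (repr (\pi_Met h)) h by apply/eqmodP; rewrite reprK.
  apply/eqP; rewrite eq_le; apply/andP; split; first exact: sub.
  by apply: sub; rewrite ae_equal_sym.
move=> eg eh; apply: le_trans (rough_dist_triangle g2 _ _) _.
rewrite (rough_dist_ae_equal eg) add0e.
apply: le_trans (rough_dist_triangle h2 _ _) _.
by rewrite (rough_dist_ae_equal (h := h1)) ?adde0// ae_equal_sym.
Qed.

Definition Met_ball (G : Met) (e : R) : set Met :=
  [set H | (Met_dist G H < e%:E)%E].

HB.instance Definition _ := hasNbhs.Build Met (nbhs_ball_ Met_ball).

Lemma Met_ball_center G e : 0 < e -> Met_ball G e G.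
Proof. by move=> e0; rewrite /Met_ball /= /Met_dist rough_dist_refl. Qed.

Lemma Met_ball_sym G H e : Met_ball G e H -> Met_ball H e G.
Proof. by rewrite /Met_ball /= /Met_dist rough_dist_sym. Qed.

Lemma Met_ball_triangle G H K e f :
  Met_ball G e H -> Met_ball H f K -> Met_ball G (e + f) K.
Proof.
rewrite /Met_ball /= EFinD => GH HK.
exact: le_lt_trans (rough_dist_triangle _ _ _) (lteD GH HK).
Qed.

Lemma Met_nbhsE : nbhs = nbhs_ (entourage_ Met_ball).
Proof.
rewrite predeq2E => G P; split=> [[e e0 eP]|[B [e e0 eB] BP]].
  exists [set GH | Met_ball GH.1 e GH.2]; first by exists e.
  by move=> H /xsectionP; exact: eP.
by exists e => // H GH; apply: BP; apply/xsectionP; exact: eB.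
Qed.

HB.instance Definition _ := Nbhs_isPseudoMetric.Build R Met
  Met_nbhsE Met_ball_center Met_ball_sym Met_ball_triangle erefl.

Definition Met_smooth : set Met :=
  [set \pi_Met g | g in [set g : rough_metric | smooth_metric g]].

Definition Met_C0 : set Met :=
  [set \pi_Met g | g in [set g : rough_metric | continuous_metric g]].

End Manifold.

Definition complete_subset {T : uniformType} (S : set T) : Prop :=
  forall u : nat -> T, (forall k, S (u k)) -> cauchy (u @ \oo) ->
    exists2 l, S l & u @ \oo --> l.

Arguments chart R n M : clear implicits.
Arguments smooth_structure R n M : clear implicits.
Arguments Met {R n M} A.
Arguments Met_smooth {R n M} A.
Arguments Met_C0 {R n M} A.

(* Main.v *)
From HB Require Import structures.
From mathcomp Require Import all_boot all_order all_algebra.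
From mathcomp Require Import all_classical all_reals all_analysis.
From mathcomp Require Import finmap ring lra.
Require Import Defs.

(** The distance compares metrics by factors: d(g, h) <= ln C when the norms of
    g and h agree up to the factor C almost everywhere, that is, the quadratic
    forms agree up to C^2. For continuous metrics a comparison that holds almost
    everywhere holds everywhere ([ae_le_everywhere]), because a nonempty open
    subset of R^n is not a null set ([open_null_set0]).

    Completeness of the continuous metrics. In a Cauchy sequence of continuous
    metrics the ratios of the quadratic forms are uniformly close to 1 at all
    points. Hence the forms converge pointwise, and the limit is positive
    definite and continuous by the argument for uniform limits, with factors in
    place of differences ([limit_field_continuous]). The limit is rough since
    it is within a bounded factor of a rough metric ([sim_rough_metric]); thus
    the set is complete ([Met_C0_complete]). It is closed ([Met_C0_closed])
    because metrics at distance 0 agree almost everywhere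
    ([rough_dist0_ae_equal], which uses that countable unions of null sets are
    null). So the closure of the smooth metrics contains continuous ones only.

    Density of the smooth metrics. Near each point a continuous metric g is
    within any prescribed factor D > 1 of a metric with constant matrix in some
    chart ([frozen_close]). Such local models are glued with cutoff functions
    f_0, f_1, ... with values in [0, 1], where the open sets on which f_k = 1
    cover M; countably many suffice as M is second countable. The weights
    f_k (1 - f_0) ... (1 - f_(k-1)) add up to 1, and on the open set where
    f_m = 1 all weights with k > m vanish: they are a locally finite partition
    of unity ([partial_sum_stable]). A convex combination of forms within the
    factor D of g is within the factor D of g, so the glued field is a smooth
    metric close to g ([glue_smooth]). The Hausdorff property makes the
    supports of the cutoffs closed, so that they extend smoothly by zero. *)

Set Implicit Arguments.
Unset Strict Implicit.
Unset Printing Implicit Defensive.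
Import Order.TTheory GRing.Theory Num.Theory.
Import numFieldNormedType.Exports.
Local Open Scope classical_set_scope.
Local Open Scope ring_scope.
Local Open Scope quotient_scope.

(** * Calculus of C^k functions *)

Section Ck.
Context {R : realType}.
Implicit Types V W : normedModType R.

(** Differentiability depends on the germ only; this makes [Ck_on] insensitive
    to a change of the function off the open set, which is what allows the
    derivative formulas below to be used although they hold on that set only. *)
Lemma near_eq_differentiable V W (f g : V -> W) (x : V) :
  (\near x, f x = g x) -> differentiable f x -> differentiable g x.
Proof.
move=> fg df; have [dfc /eqaddoP fE] := (diff_locallyP x f).1 df.
have fgx := nbhs_singleton fg.
have gE : g \o shift x = cst (g x) + 'd f x +o_ 0 id.
  apply/eqaddoP => e e0; have := fE _ e0; rewrite -fgx.
  have : \forall h \near (0 : V), f (h + x) = g (h + x).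
    move: fg; rewrite (near_shift 0 x); apply: filterS => h.
    by rewrite /= subr0.
  by apply: filterS2 => h /= fgh; rewrite /shift !fctE /= -fgh.
apply/diff_locallyP; rewrite (diff_unique dfc gE).
by split.
Qed.

Lemma eq_Ck_on V W k (U : set V) (f g : V -> W) : open U ->
  (forall x, U x -> f x = g x) -> Ck_on k U f -> Ck_on k U g.
Proof.
move=> oU; elim: k f g => [|k IH] f g fg /=.
  move=> fU x Ux; have := fU x Ux; rewrite /prop_for /continuous_at -(fg _ Ux).
  apply: cvg_trans.
  apply: near_eq_cvg; apply: filterS (open_nbhs_nbhs (conj oU Ux)) => y Uy.
  by rewrite fg.
move=> [df Df]; split=> [x Ux|v].
  apply: near_eq_differentiable (df x Ux).
  by apply: filterS (open_nbhs_nbhs (conj oU Ux)) => y /fg.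
apply: IH (Df v) => x Ux; apply: near_eq_derive.
by apply: filterS (open_nbhs_nbhs (conj oU Ux)) => y /fg.
Qed.

Lemma Ck_onS V W k (U U' : set V) (f : V -> W) : U `<=` U' ->
  Ck_on k U' f -> Ck_on k U f.
Proof.
move=> UU; elim: k f => [|k IH] f /=; first by move=> fU x /UU/fU.
by move=> [df Df]; split=> [x /UU/df//|v]; exact: IH.
Qed.

Lemma Ck_on_bigcup V W k I (D : set I) (U : I -> set V) (f : V -> W) :
  (forall i, D i -> Ck_on k (U i) f) -> Ck_on k (\bigcup_(i in D) U i) f.
Proof.
elim: k f => [|k IH] f /= fU; first by move=> x [i Di Ux]; exact: (fU i).
split=> [x [i Di Ux]|v]; first by have [+ _] := fU i Di; apply.
by apply: IH => i Di; have [_] := fU i Di; apply.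
Qed.

Lemma Ck_on_pred V W k (U : set V) (f : V -> W) : Ck_on k.+1 U f -> Ck_on k U f.
Proof.
elim: k f => [|k IH] f; last by move=> [df Df]; split=> // v; apply: IH.
by move=> [df _] x Ux; exact/differentiable_continuous/df.
Qed.

Lemma Ck_on_cst V W k (U : set V) (a : W) : Ck_on k U (cst a).
Proof.
elim: k a => [|k IH] a /=; first by move=> x _; exact: cst_continuous.
split=> [x _|v]; first exact: differentiable_cst.
rewrite (_ : 'D_v (cst a) = cst 0); first exact: IH.
by apply/funext => x; rewrite derive_cst.
Qed.

Lemma Ck_onD V W k (U : set V) (f g : V -> W) : open U ->
  Ck_on k U f -> Ck_on k U g -> Ck_on k U (f \+ g).
Proof.
move=> oU; elim: k f g => [|k IH] f g /=.
  by move=> fU gU x Ux; apply: continuousD; [exact: fU|exact: gU].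
move=> [df Df] [dg Dg]; split=> [x Ux|v].
  exact: differentiableD (df _ Ux) (dg _ Ux).
apply: eq_Ck_on (IH _ _ (Df v) (Dg v)) => // x Ux /=.
by rewrite deriveD//; apply: diff_derivable; [exact: df|exact: dg].
Qed.

Lemma Ck_onM V k (U : set V) (f g : V -> R) : open U ->
  Ck_on k U f -> Ck_on k U g -> Ck_on k U (f \* g).
Proof.
move=> oU; elim: k f g => [|k IH] f g.
  by move=> fU gU x Ux; apply: continuousM; [exact: fU|exact: gU].
move=> fk gk; have [df Df] := fk; have [dg Dg] := gk; split=> [x Ux|v].
  exact: differentiableM (df _ Ux) (dg _ Ux).
apply: eq_Ck_on (Ck_onD oU (IH _ _ (Ck_on_pred fk) (Dg v))
                         (IH _ _ (Ck_on_pred gk) (Df v))) => // x Ux /=.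
by rewrite deriveM//; apply: diff_derivable; [exact: df|exact: dg].
Qed.

(** Only outer functions of one real variable occur, for which the chain rule
    reads (b o f)' = (b' o f) f'; the induction is on k for all b at once,
    since b' replaces b. *)
Lemma Ck_on_comp V k (U : set V) (b : R -> R) (f : V -> R) : open U ->
  (forall m, Ck_on m setT b) -> Ck_on k U f -> Ck_on k U (b \o f).
Proof.
move=> oU; elim: k b f => [|k IH] b f bk.
  move=> fU x Ux; apply: continuous_comp; first exact: fU.
  exact: (bk 0).
move=> fk; have [df Df] := fk.
have db t : differentiable b t by have [+ _] := bk 1; apply.
have Db m : Ck_on m setT ('D_1 b) by have [_] := bk m.+1; apply.
split=> [x Ux|v]; first by apply: differentiable_comp; [exact: df|].
apply: eq_Ck_on (Ck_onM oU (IH _ _ Db (Ck_on_pred fk)) (Df v)) => // x Ux /=.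
rewrite [RHS]deriveE; last by apply: differentiable_comp; [exact: df|].
rewrite diff_comp//; last exact: df.
rewrite /= deriveE// (deriveE _ (df _ Ux)) mulrC.
by rewrite -[X in _ = 'd b _ X]mulr1 linearZ.
Qed.

Lemma Ck_on_linear_comp V W W' k (U : set V) (L : {linear W -> W'}) (f : V -> W) :
  open U -> continuous L -> Ck_on k U f -> Ck_on k U (L \o f).
Proof.
move=> oU cL; elim: k f => [|k IH] f.
  by move=> fU x Ux; apply: continuous_comp; [exact: fU|exact: cL].
move=> [df Df].
split=> [x Ux|v].
  by apply: differentiable_comp; [exact: df|exact: linear_differentiable].
apply: eq_Ck_on (IH _ (Df v)) => // x Ux /=.
have dL : differentiable L (f x) by exact: linear_differentiable.
rewrite [RHS]deriveE; last by apply: differentiable_comp; [exact: df|].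
by rewrite diff_comp//= ?diff_lin//?deriveE//; exact: df.
Qed.

End Ck.

(** * A smooth plateau function *)

Section Flat.
Context {R : realType}.

(** The functions t^-k exp(-1/t), extended by 0: with all exponents k at once
    the family is stable under differentiation. *)
Definition flat k (t : R) : R := if 0 < t then t^-1 ^+ k * expR (- t^-1) else 0.

Lemma flat_ge0 k t : 0 <= flat k t.
Proof.
rewrite /flat; case: ifP => // t0.
by rewrite mulr_ge0 ?expR_ge0// exprn_ge0// invr_ge0 ltW.
Qed.

Lemma flat_le0 k t : t <= 0 -> flat k t = 0.
Proof. by rewrite /flat ltNge => ->. Qed.

(** Raising 1 + s/(k+1) <= exp(s/(k+1)) to the power k+1 bounds s^(k+1) by
    a multiple of exp(s); here s = 1/t. *)
Lemma flat_bound k t : flat k t <= k.+1%:R ^+ k.+1 * `|t|.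
Proof.
rewrite /flat; case: ifP => [t0|_]; last by rewrite mulr_ge0// exprn_ge0.
have s0 : 0 < t^-1 by rewrite invr_gt0.
have c0 : 0 < k.+1%:R :> R by [].
rewrite gtr0_norm// -ler_pdivrMr// -mulrA mulrC -mulrA -exprS expRN.
rewrite mulrC ler_pdivrMr ?expR_gt0//.
rewrite (_ : expR _ = expR (t^-1 / k.+1%:R) ^+ k.+1); last first.
  by rewrite -expRM_natl mulrC divfK// gt_eqF.
rewrite -exprMn lerXn2r ?nnegrE ?mulr_ge0 ?expR_ge0 ?(ltW s0)//.
by rewrite mulrC -ler_pdivrMr// (le_trans _ (expR_ge1Dx _))// lerDr.
Qed.

Lemma flat_shift k (t : R) : t^-1 * flat k t = flat k.+1 t.
Proof. by rewrite /flat; case: ifP; rewrite ?mulr0// exprS mulrA. Qed.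

Lemma flat_cvg0 k : flat k t @[t --> (0 : R)] --> (0 : R).
Proof.
apply: (@squeeze_cvgr _ _ _ _ (cst 0) (fun t => k.+1%:R ^+ k.+1 * `|t|)).
- by apply: nearW => t; rewrite flat_ge0 flat_bound.
- exact: cvg_cst.
- rewrite -[X in _ --> X](mulr0 (k.+1%:R ^+ k.+1)); apply: cvgM; first exact: cvg_cst.
  by rewrite -[X in _ --> X](normr0 R); apply: cvg_norm; exact: cvg_id.
Qed.

(** At 0 the difference quotient of [flat k] is [flat k.+1], which tends to 0. *)
Lemma is_derive_flat k (x : R) :
  is_derive x 1 (flat k) (flat k.+2 x - k%:R * flat k.+1 x).
Proof.
have [x0|x0|->] := ltgtP x 0.
- rewrite !flat_le0 ?ltW// mulr0 subrr.
  apply: (@near_eq_is_derive _ _ _ (cst 0)).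
  by near=> y; rewrite flat_le0//; near: y; apply: filterS (lt_nbhsl x0) => y /ltW.
- have xn0 : x != 0 by rewrite gt_eqF.
  apply: (@near_eq_is_derive _ R^o R^o (fun t => t^-1 ^+ k * expR (- t^-1))).
    near=> y; rewrite /flat ifT//; near: y; exact: lt_nbhsr.
  rewrite /flat x0.
  have dV : is_derive x 1 (fun y : R => y^-1) (- x ^- 2).
    by apply: is_derive_eq; first exact: is_deriveV; rewrite /GRing.scale /= mulr1.
  have dE : is_derive x 1 (fun t : R => expR (- t^-1)) (x ^- 2 * expR (- x^-1)).
    rewrite mulrC -[x ^- 2]opprK.
    by apply: (@is_derive1_comp _ expR (fun t => - t^-1)).
  have dX : is_derive x 1 (fun t : R => t^-1 ^+ k) (- (k%:R * x^-1 ^+ k.+1)).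
    have := @is_deriveX _ _ (fun y : R => y^-1) k x 1 _ dV.
    have -> : (fun y : R => y^-1) ^+ k = (fun t : R => t^-1 ^+ k).
      by apply/funext => t; rewrite fctE.
    move/is_derive_eq; apply; rewrite /GRing.scale /=.
    case: k => [|k]; first by rewrite !mul0r oppr0.
    by rewrite -[x ^- 2]exprVn mulrN -mulrA -exprD addn2.
  have := @is_deriveM _ _ _ _ _ _ _ _ dX dE.
  move/is_derive_eq; apply.
  by rewrite /GRing.scale /= -exprVn !exprS; ring.
- rewrite !(flat_le0 _ (lexx 0)) mulr0 subrr.
  have c : (fun h => h^-1 *: ((flat k \o shift 0) (h *: 1) - flat k 0)) @ (0 : R)^' --> (0 : R).
    rewrite (_ : (fun h => _) = flat k.+1); last first.
      apply/funext => h /=; rewrite (flat_le0 _ (lexx 0)) subr0 addr0.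
      by rewrite /GRing.scale /= mulr1 flat_shift.
    exact: cvg_within_filter (@flat_cvg0 k.+1).
  by apply: DeriveDef; [apply/cvg_ex; exists 0|apply/cvg_lim].
Unshelve. all: by end_near. Qed.

Lemma derive_flat k v :
  'D_v (flat k) = (fun x => v * flat k.+2 x + - (v * k%:R) * flat k.+1 x).
Proof.
apply/funext => x; have := is_derive_flat k x => -[/derivable1_diffP df dE].
rewrite deriveE// -[X in 'd _ _ X]mulr1 linearZ /= -deriveE// dE.
by rewrite /GRing.scale /=; ring.
Qed.

Lemma Ck_on_flat m k U : open U -> Ck_on m U (flat k).
Proof.
move=> oU; elim: m k => [|m IH] k; last first.
  split=> [x _|v].
    by apply/derivable1_diffP; have [] := is_derive_flat k x.
  rewrite derive_flat.
  have Z a j : Ck_on m U (fun x => a * flat j x).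
    exact: (Ck_onM oU (Ck_on_cst _ _ a) (IH j)).
  exact: (Ck_onD oU (Z _ _) (Z _ _)).
move=> x _; apply/differentiable_continuous/derivable1_diffP.
by have [] := is_derive_flat k x.
Qed.

Lemma flat0_gt0 (t : R) : 0 < t -> 0 < flat 0 t.
Proof. by move=> t0; rewrite /flat t0 mulr_gt0 ?expR_gt0. Qed.

Lemma flat0_mono : {homo flat 0 : x y / x <= y}.
Proof.
move=> x y xy; rewrite /flat; case: ifP => x0; last first.
  by case: ifP => // _; rewrite mulr_ge0 ?expR_ge0.
have y0 := lt_le_trans x0 xy; rewrite y0 !expr0 !mul1r ler_expR lerN2.
by rewrite lef_pV2.
Qed.

(** A smooth function that is exactly constant on a half-line on either side:
    the inner difference is constant for t <= 0, and it is nonpositive for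
    t >= 1, where the outer [flat 0] vanishes. *)
Definition plateau (t : R) : R := flat 0 (flat 0 1 - flat 0 t) / flat 0 (flat 0 1).

Let c0 : 0 < flat 0 (flat 0 1).
Proof. by apply: flat0_gt0; exact: flat0_gt0. Qed.

Lemma plateau_ge0 t : 0 <= plateau t.
Proof. by rewrite divr_ge0 ?flat_ge0. Qed.

Lemma plateau_le1 t : plateau t <= 1.
Proof.
rewrite ler_pdivrMr// mul1r; apply: flat0_mono.
by rewrite lerBlDr lerDl flat_ge0.
Qed.

Lemma plateau_eq1 t : t <= 0 -> plateau t = 1.
Proof. by move=> t0; rewrite /plateau (flat_le0 _ t0) subr0 divff// gt_eqF. Qed.

Lemma plateau_eq0 t : 1 <= t -> plateau t = 0.
Proof.
by move=> t1; rewrite /plateau flat_le0 ?mul0r// subr_le0 flat0_mono.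
Qed.

Lemma Ck_on_plateau m : Ck_on m setT plateau.
Proof.
have oT : open [set: R] := openT.
have F k : Ck_on k setT (flat 0) by exact: Ck_on_flat.
have G : Ck_on m setT (fun t => flat 0 1 + - 1 * flat 0 t).
  exact: (Ck_onD oT (Ck_on_cst _ _ _) (Ck_onM oT (Ck_on_cst _ _ _) (F _))).
apply: eq_Ck_on (Ck_onM oT (Ck_on_comp oT F G)
  (Ck_on_cst m setT (flat 0 (flat 0 1))^-1)) => // t _ /=.
by rewrite /plateau mulN1r.
Qed.

End Flat.

(** * Null sets *)

Section NullSets.
Context {R : realType} {n : nat}.
Implicit Types (a b : 'rV[R]_n) (Z : set 'rV[R]_n).

Lemma box_volume_ge0 a b : (forall i, a ord0 i <= b ord0 i) -> 0 <= box_volume a b.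
Proof. by move=> ab; apply: prodr_ge0 => i _; rewrite subr_ge0. Qed.

Lemma esum_geometric (e : R) : 0 <= e ->
  (\esum_(k in [set: nat]) (e / (2 ^ k.+1)%:R)%:E <= e%:E)%E.
Proof.
move=> e0; rewrite -nneseries_esumT; first exact: epsilon_trick0.
by move=> k; rewrite lee_fin divr_ge0.
Qed.

Lemma null_set_bigcup (Z : nat -> set 'rV[R]_n) :
  (forall k, null_set (Z k)) -> null_set (\bigcup_k Z k).
Proof.
move=> nZ e e0.
have e2 k : 0 < e / (2 ^ k.+1)%:R by rewrite divr_gt0// ltr0n expn_gt0.
(* the three components are the index set and the lower and upper corners *)
pose P k (c : set nat * (nat -> 'rV[R]_n) * (nat -> 'rV[R]_n)) :=
  [/\ forall j, c.1.1 j -> forall i, c.1.2 j ord0 i <= c.2 j ord0 i,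
      Z k `<=` \bigcup_(j in c.1.1) box (c.1.2 j) (c.2 j) &
      (\esum_(j in c.1.1) (box_volume (c.1.2 j) (c.2 j))%:E
        <= (e / (2 ^ k.+1)%:R)%:E)%E].
have /choice [c cP] : forall k, exists c, P k c.
  by move=> k; have [D [a [b abP]]] := nZ k _ (e2 k); exists (D, a, b).
pose pair m : nat * nat := odflt (0, 0)%N (choice.unpickle m).
have pairK : cancel (@choice.pickle (nat * nat)%type) pair.
  by move=> u; rewrite /pair choice.pickleK.
pose D := [set: nat] `*`` (fun k => (c k).1.1).
exists (choice.pickle @` D), (fun m => (c (pair m).1).1.2 (pair m).2),
  (fun m => (c (pair m).1).2 (pair m).2); split.
- by move=> _ [u [_ Du] <-]; rewrite pairK; have [+ _ _] := cP u.1; apply.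
- move=> x [k _ Zx]; have [_ /(_ x Zx)[j Dj xj] _] := cP k.
  by exists (choice.pickle (k, j)); [exists (k, j)|rewrite pairK].
rewrite esum_image; last by move=> u v _ _; exact: can_inj pairK _ _.
under eq_esum do rewrite pairK.
rewrite -(@esum_esum _ _ _ _ _
  (fun k j => (box_volume ((c k).1.2 j) ((c k).2 j))%:E)); last first.
  move=> k j _ Dj; rewrite lee_fin box_volume_ge0//.
  by have [+ _ _] := cP k; apply.
apply: le_trans (esum_geometric (ltW e0)); apply: le_esum => k _.
by have [] := cP k.
Qed.

Lemma card_progression_le N (x d u v : R) : 0 < d -> u <= v ->
  \sum_(j < N) (u <= x + d * j%:R <= v)%R%:R <= (v - u) / d + 1.
Proof.
move=> d0 uv.
pose S := finset (fun j : 'I_N => (u <= x + d * j%:R <= v)%R).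
have -> : \sum_(j < N) (u <= x + d * j%:R <= v)%R%:R = #|S|%:R :> R.
  rewrite -sum1_card natr_sum [RHS]big_mkcond /=; apply: eq_bigr => j _.
  by rewrite inE; case: ifP.
have [->|[j0 j0S]] := set_0Vmem S.
  by rewrite cards0 addr_ge0// divr_ge0 ?subr_ge0// ltW.
case: (arg_minnP (P := mem S) (@nat_of_ord N) j0S) => p /= pS pmin.
case: (arg_maxnP (P := mem S) (@nat_of_ord N) j0S) => q /= qS qmax.
have pq : (p <= q)%N by exact: pmin.
have : (#|S| <= (q - p).+1)%N.
  rewrite cardE -(size_map val) -(size_iota p (q - p).+1).
  apply: uniq_leq_size; first by rewrite map_inj_uniq ?enum_uniq//; exact: val_inj.
  move=> _ /mapP[j jS ->]; rewrite mem_enum in jS.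
  by rewrite mem_iota pmin//= addnS subnKC// ltnS qmax.
rewrite -(ler_nat R) => /le_trans; apply.
rewrite -natr1 lerD2r natrB// ler_pdivlMr//.
by move: pS qS; rewrite !inE; lra.
Qed.

(** Counting: a grid of N^n points of mesh d / N in a cube of side d has at
    most prod_i (l_i N / d + 1) points in a box of sides l_i, so boxes that
    cover the grid have total volume at least d^n, up to the mesh. *)
Lemma grid_cover_le (I : eqType) (F : seq I) (a b : I -> 'rV[R]_n) (x : 'rV[R]_n)
    (d : R) N :
  0 < d -> (0 < N)%N -> (forall k i, a k ord0 i <= b k ord0 i) ->
  (forall f : {ffun 'I_n -> 'I_N}, exists2 k, k \in F &
     box (a k) (b k) (\row_i (x ord0 i + d / N%:R * (f i)%:R))) ->
  d ^+ n <= \sum_(k <- F) \prod_i (b k ord0 i - a k ord0 i + d / N%:R).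
Proof.
move=> d0 N0 ab cov; have N0' : 0 < N%:R :> R by rewrite ltr0n.
have dN0 : 0 < d / N%:R by rewrite divr_gt0.
pose P k i (j : 'I_N) : bool :=
  a k ord0 i <= x ord0 i + d / N%:R * j%:R <= b k ord0 i.
have le1 : N%:R ^+ n <= \sum_(k <- F) \prod_(i < n) \sum_(j < N) (P k i j)%:R :> R.
  have -> : N%:R ^+ n = \sum_(f : {ffun 'I_n -> 'I_N}) 1 :> R.
    by rewrite sumr_const card_ffun !card_ord natrX.
  under [leRHS]eq_bigr do rewrite bigA_distr_bigA.
  rewrite exchange_big /=; apply: ler_sum => f _.
  have [k kF kf] := cov f.
  have : 1 <= \prod_(i < n) (P k i (f i))%:R :> R.
    by rewrite big1// => i _; have := kf i; rewrite /P mxE => ->.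
  move=> /le_trans; apply; rewrite (big_rem k kF) /= lerDl.
  by rewrite sumr_ge0// => m _; rewrite prodr_ge0.
have -> : d ^+ n = (d / N%:R) ^+ n * N%:R ^+ n.
  by rewrite -exprMn divfK// gt_eqF.
apply: le_trans (ler_wpM2l (exprn_ge0 _ (ltW dN0)) le1) _.
rewrite mulr_sumr; apply: ler_sum => k _.
rewrite -[X in _ ^+ X](card_ord n) -prodr_const -big_split /=.
apply: ler_prod => i _; rewrite mulr_ge0 ?sumr_ge0 ?(ltW dN0)//=.
apply: le_trans (ler_wpM2l (ltW dN0) (card_progression_le _ _ dN0 (ab k i))) _.
by rewrite mulrDr mulr1 mulrCA divff ?mulr1// gt_eqF.
Qed.

End NullSets.

Lemma cvg_sum {R : realType} {T I : Type} (F : set_system T) {FF : Filter F} (r : seq I)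
    (f : I -> T -> R) (l : I -> R) :
  (forall i, f i @ F --> l i) ->
  \sum_(i <- r) f i x @[x --> F] --> \sum_(i <- r) l i.
Proof.
move=> fl; apply: (@cvg_big R I (fun x y => x + y) 0 xpredT) => //.
exact: add_continuous.
Qed.

Section OpenNotNull.
Context {R : realType} {n : nat}.
Implicit Types (a b : 'rV[R]_n) (Z : set 'rV[R]_n).

Definition open_box a b (t : R) : set 'rV[R]_n :=
  [set y | forall i, a ord0 i - t < y ord0 i < b ord0 i + t].

Lemma open_open_box a b t : open (open_box a b t).
Proof.
rewrite openE => y yab.
have H i : nbhs y [set z : 'rV[R]_n | a ord0 i - t < z ord0 i < b ord0 i + t].
  have /andP[ya yb] := yab i.
  have yc : (fun z : 'rV[R]_n => z ord0 i) @ y --> y ord0 i.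
    exact: coord_continuous.
  suff : nbhs (y ord0 i) [set s | a ord0 i - t < s < b ord0 i + t] by move/yc.
  near=> z; apply/andP; split; near: z; first exact: lt_nbhsr.
  exact: lt_nbhsl.
exact: (@filter_forall _ _ _ (nbhs y) _ H).
Unshelve. all: by end_near. Qed.

Lemma enlarged_volume_cvg a b :
  \prod_i (b ord0 i - a ord0 i + t) @[t --> (0 : R)] --> box_volume a b.
Proof.
apply: (@cvg_big R _ (fun x y => x * y) 1 xpredT) => [|i _].
  exact: mul_continuous.
rewrite -[X in _ --> X]addr0; apply: cvgD; [exact: cvg_cst|exact: cvg_id].
Qed.

(** The limit of [grid_cover_le] as the mesh tends to 0. *)
Lemma cover_volume_ge (I : eqType) (F : seq I) (a b : I -> 'rV[R]_n)
    (x : 'rV[R]_n) (d : R) :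
  0 < d -> (forall k i, a k ord0 i <= b k ord0 i) ->
  (forall y : 'rV[R]_n, (forall i, x ord0 i <= y ord0 i <= x ord0 i + d) ->
     exists2 k, k \in F & box (a k) (b k) y) ->
  d ^+ n <= \sum_(k <- F) box_volume (a k) (b k).
Proof.
move=> d0 ab cov.
have cvgF : \sum_(k <- F) \prod_i (b k ord0 i - a k ord0 i + t) @[t --> (0 : R)]
    --> \sum_(k <- F) box_volume (a k) (b k).
  by apply: cvg_sum => k; exact: enlarged_volume_cvg.
have dN : d / N.+1%:R @[N --> \oo] --> (0 : R).
  rewrite -[X in _ --> X](mulr0 d); apply: cvgM; first exact: cvg_cst.
  exact: cvg_harmonic.
have cN := cvg_comp _ _ dN cvgF.
rewrite -(cvg_lim _ cN)//; apply: limr_ge.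
  by apply/cvg_ex; eexists; exact: cN.
apply: nearW => N; apply: (grid_cover_le (x := x)) => // f.
apply: cov => i; rewrite !mxE lerDl mulr_ge0 ?divr_ge0 ?(ltW d0)//=.
by rewrite lerD2l -[leRHS]mulr1 -mulrA ler_pM2l// mulrC ler_pdivrMr// mul1r ler_nat ltnW.
Qed.

(** A closed cube in the open set is compact; a countable cover by boxes of
    small total volume, each box being enlarged a little to an open one, has a
    finite subcover, which contradicts [cover_volume_ge]. *)
Lemma open_null_set0 (U : set 'rV[R]_n) : open U -> null_set U -> U = set0.
Proof.
move=> oU nU; apply/seteqP; split=> // x Ux; exfalso.
have /nbhs_ballP[r /= r0 rU] := open_nbhs_nbhs (conj oU Ux).
have r20 : 0 < r / 2 by rewrite divr_gt0.
(* the enlargement costs another e, and 2 e is still less than the volume *)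
pose e := (r / 2) ^+ n / 4.
have e0 : 0 < e by rewrite divr_gt0// exprn_gt0.
have [D [a [b [ab UD volD]]]] := nU e e0.
have /choice[t tP] : forall k, exists t : R, 0 < t /\ (D k ->
    \prod_i (b k ord0 i - a k ord0 i + 2 * t)
      <= box_volume (a k) (b k) + e / (2 ^ k.+1)%:R).
  move=> k.
  have c : \prod_i (b k ord0 i - a k ord0 i + 2 * t) @[t --> 0^'+]
      --> box_volume (a k) (b k).
    have c2 : 2 * t @[t --> (0 : R)^'+] --> (0 : R).
      apply: cvg_at_right_filter; rewrite -[X in _ --> X](mulr0 2).
      by apply: cvgM; [exact: cvg_cst|exact: cvg_id].
    exact: (cvg_comp _ _ c2 (@enlarged_volume_cvg (a k) (b k))).
  have ek : box_volume (a k) (b k) < box_volume (a k) (b k) + e / (2 ^ k.+1)%:R.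
    by rewrite ltrDl divr_gt0// ltr0n expn_gt0.
  have near1 := cvgr_le _ c _ ek.
  near (0 : R)^'+ => t; exists t; split; first by near: t; exact: nbhs_right_gt.
  by move=> _; near: t; exact: near1.
pose K : set 'rV[R]_n := [set y | forall i, `[x ord0 i, x ord0 i + r / 2]%classic (y ord0 i)].
have cK : compact K.
  apply: (@rV_compact _ _ (fun i => `[x ord0 i, x ord0 i + r / 2]%classic)) => i.
  exact: segment_compact.
have KU : K `<=` U.
  move=> y Ky; apply: rU; split=> // i0 i; rewrite ord1 -ball_normE /=.
  have := Ky i; rewrite /= in_itv/= => /andP[y1 y2].
  rewrite distrC ger0_norm ?subr_ge0// (@le_lt_trans _ _ (r / 2))//.
    by rewrite lerBlDl.
  by rewrite gtr_pMr// invf_lt1// ltr1n.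
move: cK; rewrite compact_cover.
have open_boxes k : D k -> open (open_box (a k) (b k) (t k)) by move=> _; exact: open_open_box.
have Kc : K `<=` cover D (fun k => open_box (a k) (b k) (t k)).
  move=> y /KU /UD [k Dk yk]; exists k => // i; have /andP[h1 h2] := yk i.
  by have [t0 _] := tP k; apply/andP; split; lra.
move=> /(_ nat D _ open_boxes Kc)[F FD KF].
(* the default corners keep lower corners below upper ones also off D *)
pose a' k := if k \in D then a k - const_mx (t k) else 0.
pose b' k := if k \in D then b k + const_mx (t k) else 0.
have : (r / 2) ^+ n <= \sum_(k <- finmap.enum_fset F) box_volume (a' k) (b' k).
  apply: (@cover_volume_ge _ _ _ _ x) => //.
    move=> k i; rewrite /a' /b'; case: ifP => // /set_mem Dk.
    have [t0 _] := tP k; rewrite !mxE (le_trans _ (le_trans (ab k Dk i) _))//.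
      by rewrite lerBlDr lerDl ltW.
    by rewrite lerDl ltW.
  move=> y yK.
  have /KF[k /= kF yk] : K y by move=> i; rewrite /= in_itv/=; exact: yK.
  exists k => // i; rewrite /a' /b' (FD _ kF).
  by rewrite !mxE; have /andP[/ltW h1 /ltW h2] := yk i; rewrite h1.
apply/negP; rewrite -ltNge.
apply: (@le_lt_trans _ _ (e + e)); last first.
  by rewrite /e -mulrDl; have := exprn_gt0 n r20; lra.
have vol k : k \in finmap.enum_fset F -> box_volume (a' k) (b' k)
    <= box_volume (a k) (b k) + e / (2 ^ k.+1)%:R.
  move=> /FD kD; have [_ /(_ (set_mem kD))] := tP k.
  apply: le_trans; rewrite le_eqVlt; apply/orP; left; apply/eqP.
  apply: eq_bigr => i _; rewrite /a' /b' kD !mxE; ring.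
apply: (@le_trans _ _ (\sum_(k <- finmap.enum_fset F) (box_volume (a k) (b k) + e / (2 ^ k.+1)%:R))).
  by rewrite big_seq [leRHS]big_seq; apply: ler_sum.
have fin (S : set nat) (v : nat -> R) (w : R) : [set` F] `<=` S ->
    (\esum_(k in S) (v k)%:E <= w%:E)%E -> \sum_(k <- finmap.enum_fset F) v k <= w.
  move=> FS; rewrite -lee_fin -sumEFin; apply: le_trans.
  apply: ereal_sup_ubound; exists [set` F]; first by split=> //; exact: finite_fset.
  by rewrite fsbig_finite ?set_fsetK//; exact: finite_fset.
rewrite big_split lerD//; first by apply: (fin D) => // k /= /FD /set_mem.
by apply: (fin setT) => //; exact: esum_geometric (ltW e0).
Unshelve. all: by end_near. Qed.

End OpenNotNull.

(** * Symmetric bilinear forms *)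

Section SymmetricForms.
Context {R : realType} {U : lmodType R}.

Lemma sym_formDl (f : {symmetric U}) u v w : f (u + v) w = f u w + f v w.
Proof. exact: linearDl. Qed.

Lemma sym_formZl (f : {symmetric U}) a u w : f (a *: u) w = a * f u w.
Proof. exact: linearZl_LR. Qed.

Lemma sym_formC (f : {symmetric U}) u v : f u v = f v u.
Proof. by have := @hermitian_subproof _ _ _ _ f u v; rewrite expr0 mul1r. Qed.

Lemma sym_formDr (f : {symmetric U}) u v w : f w (u + v) = f w u + f w v.
Proof. by rewrite sym_formC sym_formDl ![f _ w]sym_formC. Qed.

Lemma sym_formZr (f : {symmetric U}) a u w : f w (a *: u) = a * f w u.
Proof. by rewrite sym_formC sym_formZl sym_formC. Qed.

Lemma sym_form_suml (f : {symmetric U}) I (r : seq I) (E : I -> U) w :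
  f (\sum_(i <- r) E i) w = \sum_(i <- r) f (E i) w.
Proof.
elim: r => [|i r IH]; last by rewrite !big_cons sym_formDl IH.
by rewrite !big_nil -[0 in LHS](scale0r 0) sym_formZl mul0r.
Qed.

Lemma polarization (f : {symmetric U}) u v :
  f u v = 2^-1 * (f (u + v) (u + v) - f u u - f v v).
Proof. by rewrite !(sym_formDl, sym_formDr) [f v u]sym_formC; field. Qed.

Section Build.
Variable f : U -> U -> R.
Hypothesis fC : forall u v, f u v = f v u.
Hypothesis fP : forall a u v w, f (a *: u + v) w = a * f u w + f v w.

Let f_bilinear : bilinear_for ( *%R : GRing.Scale.law R R)
  ((idfun : R -> R) \; *%R : GRing.Scale.law R R) f.
Proof.
split=> [w|w] a u v; first exact: fP.
by rewrite fC fP [f u w]fC [f v w]fC.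
Qed.

Let f_hermitian u v : f u v = (-1) ^+ false * idfun (f v u).
Proof. by rewrite expr0 mul1r fC. Qed.

Definition symmetric_form_of : {symmetric U} :=
  HB.pack f (bilinear_isBilinear.Build R U U R
    ( *%R : GRing.Scale.law R R) ((idfun : R -> R) \; *%R : GRing.Scale.law R R)
    f f_bilinear)
    (isHermitianSesquilinear.Build R U false idfun f f_hermitian).

Lemma symmetric_form_ofE u v : symmetric_form_of u v = f u v.
Proof. by []. Qed.

End Build.

End SymmetricForms.

(** * Tensor fields in charts *)

Section Charts.
Context {R : realType} {n : nat} {M : topologicalType}.
Variable A : smooth_structure R n M.
Implicit Types (c d : chart R n M) (g h : tensor_field A).

Lemma tangent_ofP c x a (v w : 'rV[R]_n) :
  tangent_of A c x (a *: v + w) = a *: tangent_of A c x v + tangent_of A c x w.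
Proof.
apply: val_inj; apply/funext => d /=.
rewrite /GRing.add /= /GRing.scale /=.
by case: asboolP => [_|_]; rewrite ?linearP// scaler0 addr0.
Qed.

Lemma tangent_ofD c x (v w : 'rV[R]_n) :
  tangent_of A c x (v + w) = tangent_of A c x v + tangent_of A c x w.
Proof. by rewrite -[v]scale1r tangent_ofP !scale1r. Qed.

Lemma tangent_of0 c x : tangent_of A c x 0 = 0.
Proof. by apply: (addrI (tangent_of A c x 0)); rewrite -tangent_ofD !addr0. Qed.

Lemma tangent_ofZ c x a (v : 'rV[R]_n) :
  tangent_of A c x (a *: v) = a *: tangent_of A c x v.
Proof. by rewrite -[a *: v]addr0 tangent_ofP tangent_of0 addr0. Qed.

Lemma tangent_of_eq0 c x v : chart_at A x c ->
  (tangent_of A c x v == 0) = (v == 0).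
Proof.
move=> cx; apply/eqP/eqP => [/(congr1 (coord c))|->]; last exact: tangent_of0.
rewrite tangent_ofK// -(tangent_of0 c x) tangent_ofK//.
Qed.

(** g evaluated on the vector fields with constant coordinates v and w in the
    chart c; the components of g are the case of basis vectors. *)
Definition in_chart g c (v w : 'rV[R]_n) (y : 'rV[R]_n) : R :=
  g (bwd c y) (tangent_of A c (bwd c y) v) (tangent_of A c (bwd c y) w).

Lemma in_chart_components g c v w :
  in_chart g c v w = fun y =>
    \sum_i \sum_j v ord0 i * w ord0 j * component g c i j y.
Proof.
apply/funext => y; rewrite /in_chart [v in LHS]row_sum_delta.
have tsum (E : 'I_n -> 'rV[R]_n) : tangent_of A c (bwd c y) (\sum_i E i) =
    \sum_i tangent_of A c (bwd c y) (E i).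
  by apply: (big_morph _ (@tangent_ofD c (bwd c y)) (tangent_of0 c _)).
rewrite tsum sym_form_suml; apply: eq_bigr => i _.
rewrite [w in LHS]row_sum_delta tsum sym_formC sym_form_suml; apply: eq_bigr => j _.
by rewrite sym_formC !tangent_ofZ sym_formZl sym_formZr mulrA.
Qed.

Lemma in_chart_fwd g c x u v : chart_at A x c ->
  in_chart g c (coord c u) (coord c v) (fwd c x) = g x u v.
Proof.
move=> cx; have xE : bwd c (fwd c x) = x by rewrite fwdK//; case: cx.
rewrite /in_chart.
have E (y : M) : y = x -> g y (tangent_of A c y (coord c u))
    (tangent_of A c y (coord c v)) = g x u v.
  by move=> ->; rewrite !coordK.
exact: E.
Qed.

Lemma bwdK c y : codom c y -> dom c (bwd c y) /\ fwd c (bwd c y) = y.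
Proof. by move=> [x cx <-]; rewrite fwdK. Qed.

Lemma chart_at_bwd c y : atlas A c -> codom c y -> chart_at A (bwd c y) c.
Proof. by move=> Ac /bwdK[]. Qed.

Definition continuous_field g : Prop :=
  forall c i j, atlas A c -> {within codom c, continuous (component g c i j)}.

Lemma in_chart_continuous g c v w y : continuous_field g -> atlas A c ->
  codom c y -> {for y, continuous (in_chart g c v w)}.
Proof.
move=> gc Ac cy; rewrite in_chart_components.
rewrite /prop_for /continuous_at; apply: (@cvg_sum _ _ _ (nbhs y)) => i.
apply: (@cvg_sum _ _ _ (nbhs y)) => j.
apply: cvgM; first exact: cvg_cst.
have := gc c i j Ac; rewrite continuous_open_subspace; last exact: open_codom.
by move=> /(_ y); apply; exact: mem_set.
Qed.

(** By polarization, continuity may be checked on the quadratic form alone. *)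
Lemma continuous_fieldP g :
  (forall c v y, atlas A c -> codom c y -> {for y, continuous (in_chart g c v v)}) ->
  continuous_field g.
Proof.
move=> gc c i j Ac; rewrite continuous_open_subspace; last exact: open_codom.
move=> y /set_mem cy.
rewrite (_ : component g c i j = fun y => 2^-1 *
  (in_chart g c (delta_mx ord0 i + delta_mx ord0 j) (delta_mx ord0 i + delta_mx ord0 j) y
   - in_chart g c (delta_mx ord0 i) (delta_mx ord0 i) y
   - in_chart g c (delta_mx ord0 j) (delta_mx ord0 j) y)); last first.
  by apply/funext => z; rewrite /component polarization /in_chart !tangent_ofD.
exact: (cvgM (cvg_cst _)
  (cvgB (cvgB (gc _ _ _ Ac cy) (gc _ _ _ Ac cy)) (gc _ _ _ Ac cy))).
Qed.

(** The set where a continuous f is positive is open and null, hence empty. *)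
Lemma ae_chart_le0 c (f : 'rV[R]_n -> R) : atlas A c ->
  (forall y, codom c y -> {for y, continuous f}) ->
  almost_everywhere A (fun x => dom c x -> f (fwd c x) <= 0) ->
  forall y, codom c y -> f y <= 0.
Proof.
move=> Ac fc fae y cy; rewrite leNgt; apply/negP => fy.
pose O : set 'rV[R]_n := codom c `&` f @^-1` [set t | 0 < t].
have oO : open O.
  have : {in codom c, continuous f} by move=> z /set_mem; exact: fc.
  rewrite continuous_inP; last exact: open_codom.
  by apply; exact: open_gt.
have : O = set0.
  apply: open_null_set0 => //; apply: null_setS (fae c Ac).
  move=> z [[x cx <-] /= fx]; exists x => //; split=> //= /(_ cx).
  by rewrite leNgt fx.
by move=> /seteqP[/(_ y) + _]; apply; split.
Qed.

Lemma ae_le_everywhere g h (K : R) : continuous_field g -> continuous_field h ->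
  almost_everywhere A (fun x => forall u, h x u u <= K * g x u u) ->
  forall x u, h x u u <= K * g x u u.
Proof.
move=> gc hc gh x u; have [c Ac cx] := atlas_cover A x.
have cAx : chart_at A x c by [].
rewrite -(in_chart_fwd h u u cAx) -(in_chart_fwd g u u cAx) -subr_le0.
pose f y := in_chart h c (coord c u) (coord c u) y
  - K * in_chart g c (coord c u) (coord c u) y.
apply: (@ae_chart_le0 c f) => //; last by exists x.
  move=> y cy.
  exact: (cvgB (in_chart_continuous hc Ac cy)
    (cvgM (cvg_cst K) (in_chart_continuous gc Ac cy))).
apply: ae_and (gh) (gh) => y ghy _ cy; rewrite subr_le0 /in_chart fwdK//.
Qed.

(** The sets whose preimage is Borel form a sigma-algebra that contains the
    open intervals; the exceptional null set is empty. *)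
Lemma continuous_measurable_field g : continuous_field g -> measurable_field g.
Proof.
move=> gc c i j Ac B mB; exists (codom c `&` component g c i j @^-1` B); last first.
  by rewrite setYK; exact: null_set0.
set D := codom c; set f := component g c i j.
have oD : open D := @open_codom _ _ _ c.
pose T := g_sigma_algebraType [set U : set 'rV[R]_n | open U].
have mo (U : set 'rV[R]_n) : open U -> @measurable _ T U.
  by move=> oU; exact: sub_sigma_algebra.
suff : @measurable _ T (D `&` f @^-1` B) by [].
have mB' : (@measurable_realfun.RGenOpens.G R).-sigma.-measurable B.
  by rewrite -measurable_realfun.RGenOpens.measurableE.
have {mB mB'} : <<s @measurable_realfun.RGenOpens.G R >> B := mB'.
move: B; apply: smallest_sub; first split.
- by rewrite /= preimage_set0 setI0; exact: measurable0.
- move=> B /= mB; rewrite setTD preimage_setC.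
  rewrite (_ : D `&` _ = D `\` (D `&` f @^-1` B)).
    by apply: measurableD => //; exact: mo.
  by rewrite setDIr setDv set0U.
- move=> F mF /=; rewrite preimage_bigcup setI_bigcupr.
  exact: bigcup_measurable.
move=> _ [a [b ->]] /=; apply: mo.
have : {in D, continuous f}.
  by rewrite -continuous_open_subspace//; exact: gc.
by rewrite continuous_inP//; apply; exact: interval_open.
Qed.

End Charts.

(** * Comparing metrics by factors *)

Section Comparison.
Context {R : realType} {n : nat} {M : topologicalType}.
Context {A : smooth_structure R n M}.
Implicit Types (c d : chart R n M) (g h : tensor_field A).

Lemma positive_definite_ge0 g x u : positive_definite g -> 0 <= g x u u.
Proof.
move=> gpos; have [->|u0] := eqVneq u 0; last exact/ltW/gpos.
by rewrite -[X in g x X _](scale0r 0) sym_formZl mul0r.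
Qed.

Lemma sqrt_le_quad (C a b : R) : 0 < C -> 0 <= a ->
  (Num.sqrt b <= C * Num.sqrt a) = (b <= C ^+ 2 * a).
Proof.
move=> C0 a0; have -> : C * Num.sqrt a = Num.sqrt (C ^+ 2 * a).
  by rewrite sqrtrM ?exprn_ge0 ?(ltW C0)// sqrtr_sqr gtr0_norm.
have [b0|b0] := leP 0 b; first by rewrite ler_sqrt// mulr_ge0// exprn_ge0// ltW.
have Ca : 0 <= C ^+ 2 * a by rewrite mulr_ge0// exprn_ge0// ltW.
by rewrite (ler0_sqrtr (ltW b0)) sqrtr_ge0 (le_trans (ltW b0)).
Qed.

(** Comparison of quadratic forms at every point. Norms are square roots, so
    the factor C for norms corresponds to C^2 here. *)
Definition quad_le (K : R) g h : Prop := forall x u, h x u u <= K * g x u u.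

Lemma quad_le_sim C g h : 0 < C -> positive_definite g -> positive_definite h ->
  quad_le (C ^+ 2) g h -> quad_le (C ^+ 2) h g -> sim_metric C g h.
Proof.
move=> C0 gpos hpos gh hg; apply: aeT => x u.
rewrite ler_pdivrMl// /tnorm !sqrt_le_quad ?positive_definite_ge0//.
by rewrite gh hg.
Qed.

Lemma sim_quad_le C g h : 0 < C -> continuous_metric g -> continuous_metric h ->
  sim_metric C g h -> quad_le (C ^+ 2) g h /\ quad_le (C ^+ 2) h g.
Proof.
move=> C0 [gpos gc] [hpos hc] gh; split; apply: ae_le_everywhere => //;
  apply: ae_and (gh) (gh) => x ghx _ u; have := ghx u;
  rewrite ler_pdivrMl// /tnorm !sqrt_le_quad ?positive_definite_ge0//;
  by case/andP.
Qed.

Lemma rough_dist_lt g h (e : R) : (rough_dist g h < e%:E)%E ->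
  exists C, [/\ 1 <= C, ln C < e & sim_metric C g h].
Proof. by move=> /ereal_inf_lt[_ [C [C1 gh] <-]]; rewrite lte_fin; exists C. Qed.

Lemma sim_rough_dist C g h : 1 <= C -> sim_metric C g h ->
  (rough_dist g h <= (ln C)%:E)%E.
Proof. by move=> C1 gh; apply: ereal_inf_lbound; exists C. Qed.

(** The local comparison with a Euclidean metric is inherited along a bounded
    factor, so only measurability has to be known for h. *)
Lemma sim_rough_metric C g h : 1 <= C -> sim_metric C g h ->
  measurable_field h -> rough_metric_axiom g -> rough_metric_axiom h.
Proof.
move=> C1 gh hm [_ grough]; split=> // x.
have C0 : 0 < C by rewrite (lt_le_trans _ C1).
have [c [cx [K K1 gK]]] := grough x; exists c; split=> //.
have K0 : 0 < K by rewrite (lt_le_trans _ K1).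
exists (C * K); first by rewrite mulr_ege1.
apply: ae_and gh gK => y ghy gKy cy u.
have /andP[h1 h2] := ghy u; have /andP[k1 k2] := gKy cy u.
rewrite ler_pdivrMl// in h1; rewrite ler_pdivrMl// in k1.
rewrite ler_pdivrMl ?mulr_gt0//; apply/andP; split.
  by rewrite (le_trans k1)// [C * K]mulrC -mulrA ler_pM2l.
by rewrite (le_trans h1)// -mulrA ler_pM2l.
Qed.

End Comparison.

(** * Limits of Cauchy sequences of continuous metrics *)

Lemma ratio_cauchy_cvg {R : realType} (q : nat -> R) : (forall k, 0 <= q k) ->
  (forall D, 1 < D -> exists N, forall k l, (N <= k)%N -> (N <= l)%N ->
     q l <= D * q k) -> cvgn q.
Proof.
move=> q0 qc; apply: cauchy_cvg; apply: cauchy_exP => e e0.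
have [N1 qN1] := qc 2 (ltr1n _ _).
pose B := 2 * q N1.
have B0 : 0 <= B by rewrite mulr_ge0.
have D1 : 1 < 1 + e / (B + 1) by rewrite ltrDl divr_gt0// ltr_wpDl.
have [N2 qN2] := qc _ D1.
pose N := maxn N1 N2; exists (q N).
have DB k : (N <= k)%N -> e / (B + 1) * q k < e.
  move=> Nk; rewrite mulrAC ltr_pdivrMr ?ltr_wpDl// ltr_pM2l//.
  apply: (@le_lt_trans _ _ B); last by rewrite ltrDl.
  by apply: qN1 => //; rewrite (leq_trans _ Nk)// leq_maxl.
exists N => // k /= Nk; rewrite -ball_normE /= ltr_norml.
have NN : (N2 <= N)%N by rewrite leq_maxr.
have h1 := qN2 N k NN (leq_trans NN Nk).
have h2 := qN2 k N (leq_trans NN Nk) NN.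
have h3 := DB _ (leqnn N); have h4 := DB _ Nk.
rewrite !mulrDl !mul1r in h1 h2.
by apply/andP; split; lra.
Qed.

(** Continuity at a point where f is positive, expressed by ratios: this form
    is stable under limits of metrics, which converge in ratio. *)
Lemma ratio_continuous {R : realType} {T : topologicalType} (f : T -> R) (y : T) :
  0 < f y ->
  (forall D, 1 < D -> \forall z \near y, f z <= D * f y /\ f y <= D * f z) ->
  {for y, continuous f}.
Proof.
move=> fy0 fD; apply/cvgrPdist_le => e e0 /=.
have D1 : 1 < 1 + e / f y by rewrite ltrDl divr_gt0.
have [D0 D1'] : 0 < 1 + e / f y /\ 0 <= e / f y by split; lra.
apply: filterS (fD _ D1) => z [h1 h2].
have ef : e / f y * f y = e by rewrite divfK// gt_eqF.
rewrite mulrDl mul1r ef in h1; rewrite mulrDl mul1r in h2.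
rewrite ler_norml; apply/andP; split; first lra.
have [fzy|fyz] := leP (f z) (f y); last by lra.
have : e / f y * f z <= e / f y * f y by rewrite ler_wpM2l.
lra.
Qed.

Section Limit.
Context {R : realType} {n : nat} {M : topologicalType}.
Context {A : smooth_structure R n M}.
Variable g_ : nat -> tensor_field A.
Hypothesis g_cont : forall k, continuous_metric (g_ k).
Hypothesis g_cauchy : forall D, 1 < D -> exists N, forall k l,
  (N <= k)%N -> (N <= l)%N -> quad_le D (g_ k) (g_ l).

Lemma quad_cvg x u : cvgn (fun k => g_ k x u u).
Proof.
apply: ratio_cauchy_cvg => [k|D D1].
  by apply: positive_definite_ge0; have [] := g_cont k.
by have [N gN] := g_cauchy D1; exists N => k l Nk Nl; exact: gN.
Qed.

Definition limit_form x (u v : tangent A x) : R := limn (fun k => g_ k x u v).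

(** The quadratic forms converge by [ratio_cauchy_cvg], hence so do their
    polarizations. *)
Lemma limit_form_cvg x u v : g_ k x u v @[k --> \oo] --> limit_form u v.
Proof.
suff : cvgn (fun k => g_ k x u v) by [].
rewrite (_ : (fun k => _) = fun k =>
  2^-1 * (g_ k x (u + v) (u + v) - g_ k x u u - g_ k x v v)); last first.
  by apply/funext => k; exact: polarization.
apply/cvg_ex; eexists; apply: cvgM; first exact: cvg_cst.
apply: cvgB; [apply: cvgB|]; exact: quad_cvg.
Qed.

Let limit_formC x (u v : tangent A x) : limit_form u v = limit_form v u.
Proof. by congr (limn _); apply/funext => k; exact: sym_formC. Qed.

Let limit_formP x a (u v w : tangent A x) :
  limit_form (a *: u + v) w = a * limit_form u w + limit_form v w.
Proof.
rewrite [LHS]/limit_form; apply: cvg_lim => //.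
under eq_fun do rewrite sym_formDl sym_formZl.
apply: cvgD; last exact: limit_form_cvg.
by apply: cvgM; [exact: cvg_cst|exact: limit_form_cvg].
Qed.

Definition limit_field : tensor_field A := fun x =>
  symmetric_form_of (@limit_formC x) (@limit_formP x).

Lemma limit_field_quad_le D : 1 < D -> exists N, forall k, (N <= k)%N ->
  quad_le D (g_ k) limit_field /\ quad_le D limit_field (g_ k).
Proof.
move=> D1; have [N gN] := g_cauchy D1; exists N => k Nk; split=> x u.
  apply: (cvgr_to_le (@limit_form_cvg x u u)).
  by near=> l; apply: gN => //; near: l; exact: nbhs_infty_ge.
apply: (cvgr_to_ge (cvgM (cvg_cst D) (@limit_form_cvg x u u))).
by near=> l; apply: gN => //; near: l; exact: nbhs_infty_ge.
Unshelve. all: by end_near. Qed.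

Lemma limit_field_positive : positive_definite limit_field.
Proof.
move=> x u u0; have [N gN] := limit_field_quad_le (ltr1n R 2).
have [_ /(_ x u)] := gN N (leqnn N); have [/(_ x u u0) + _] := g_cont N.
by lra.
Qed.

(** The usual three steps for a uniform limit: from the limit to a member of
    the sequence at z, from z to y for this member, and back to the limit at y;
    each step costs a factor D', where D'^3 = D. *)
Lemma limit_field_continuous : continuous_field limit_field.
Proof.
apply: continuous_fieldP => c v y Ac cy.
have [->|v0] := eqVneq v 0.
  rewrite (_ : in_chart _ _ _ _ = cst 0); first exact: cst_continuous.
  apply/funext => z; rewrite /in_chart tangent_of0.
  by rewrite -[X in limit_field _ X _](scale0r 0) sym_formZl mul0r.
have u0 : tangent_of A c (bwd c y) v != 0.
  by rewrite tangent_of_eq0//; exact: chart_at_bwd.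
apply: ratio_continuous; first exact: limit_field_positive.
move=> D D1.
pose D' := expR (ln D / 3).
have D0 : 0 < D by rewrite (lt_trans _ D1).
have D'1 : 1 < D' by rewrite expR_gt1 divr_gt0// ln_gt0.
have D'0 : 0 < D' by rewrite (lt_trans _ D'1).
have DE : D = D' * (D' * D').
  rewrite -!expRD -[LHS](lnK (x := D)) ?posrE//.
  by congr expR; field.
have [N gN] := limit_field_quad_le D'1.
have [gl lg] := gN N (leqnn N).
have [gpos gc] := g_cont N.
pose q := in_chart (g_ N) c v v.
have qy0 : 0 < q y by exact: gpos.
have qc := in_chart_continuous (v := v) (w := v) gc Ac cy.
have near1 : \forall z \near y, q z <= D' * q y.
  by apply: (cvgr_le _ qc); rewrite ltr_pMl.
have near2 : \forall z \near y, D'^-1 * q y <= q z.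
  by apply: (cvgr_ge _ qc); rewrite gtr_pMl// invf_lt1.
apply: filterS2 near1 near2 => z h1 h2.
rewrite ler_pdivrMl// in h2.
have L (w : 'rV[R]_n) : in_chart limit_field c v v w <= D' * q w by exact: gl.
have L' (w : 'rV[R]_n) : q w <= D' * in_chart limit_field c v v w by exact: lg.
rewrite DE -!mulrA; split.
  apply: le_trans (L z) _; rewrite ler_pM2l//; apply: le_trans h1 _.
  by rewrite ler_pM2l.
apply: le_trans (L y) _; rewrite ler_pM2l//; apply: le_trans h2 _.
by rewrite ler_pM2l.
Unshelve. all: by end_near. Qed.

End Limit.

Section Complete.
Context {R : realType} {n : nat} {M : topologicalType}.
Context {A : smooth_structure R n M}.

Lemma ae_forall (P : nat -> M -> Prop) :
  (forall k, almost_everywhere A (P k)) ->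
  almost_everywhere A (fun x => forall k, P k x).
Proof.
move=> aeP c Ac; apply: null_setS (null_set_bigcup (fun k => aeP k c Ac)).
move=> _ [x [/= /existsNP[k nPk] cx] <-].
by exists k => //; exists x.
Qed.

Lemma le_of_le_harmonic (a b : R) : (forall k, a <= (1 + k.+1%:R^-1) * b) -> a <= b.
Proof.
move=> ab.
have c : (1 + k.+1%:R^-1) * b @[k --> \oo] --> (1 + 0) * b.
  by apply: cvgM; [apply: cvgD; [exact: cvg_cst|exact: cvg_harmonic]|exact: cvg_cst].
rewrite addr0 mul1r in c.
by apply: (cvgr_to_ge c); exact: nearW.
Qed.

(** The norms agree off a countable union of null sets. A square root does not
    determine a negative number, but the positivity of h makes the common norm
    positive, which forces g to be positive as well. *)
Lemma rough_dist0_ae_equal (g h : rough_metric A) : positive_definite h ->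
  rough_dist g h = 0%E -> ae_equal g h.
Proof.
move=> hpos gh0; apply/asboolP.
pose P k x := forall u : tangent A x, tnorm h u <= (1 + k.+1%:R^-1) * tnorm g u /\
  tnorm g u <= (1 + k.+1%:R^-1) * tnorm h u.
have aeP k : almost_everywhere A (P k).
  have k1 : 1 < 1 + k.+1%:R^-1 :> R by rewrite ltrDl.
  have : (rough_dist g h < (ln (1 + k.+1%:R^-1))%:E)%E.
    by rewrite gh0 lte_fin ln_gt0.
  move=> /rough_dist_lt[C [C1 Ck gh]].
  have C0 : 0 < C by rewrite (lt_le_trans _ C1).
  have Ck' : C <= 1 + k.+1%:R^-1.
    by rewrite -ler_ln ?posrE// ?ltW// (lt_trans _ k1).
  apply: ae_and (gh) (gh) => x ghx _ u; have /andP[h1 h2] := ghx u.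
  rewrite ler_pdivrMl// in h1.
  by split; [apply: le_trans h1 _|apply: le_trans h2 _]; rewrite ler_wpM2r ?sqrtr_ge0.
apply: ae_and (ae_forall aeP) (ae_forall aeP) => x Px _.
have tE (u : tangent A x) : tnorm g u = tnorm h u.
  by apply/eqP; rewrite eq_le; apply/andP; split; apply: le_of_le_harmonic => k;
    have [] := Px k u.
have qE (u : tangent A x) : rough_field g x u u = rough_field h x u u.
  have [->|u0] := eqVneq u 0.
    by rewrite -[X in _ X _ = _](scale0r 0) -[X in _ = _ X _](scale0r 0) !sym_formZl !mul0r.
  have hu0 := hpos x u u0.
  have gu0 : 0 < rough_field g x u u.
    by rewrite -sqrtr_gt0 -/(tnorm _ _) tE sqrtr_gt0.
  by rewrite -[LHS]sqr_sqrtr ?ltW// -[RHS]sqr_sqrtr ?ltW// -!/(tnorm _ _) tE.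
by move=> u v; rewrite polarization [RHS]polarization !qE.
Qed.

Lemma quad_leS (K L : R) (g h : tensor_field A) : positive_definite g ->
  K <= L -> quad_le K g h -> quad_le L g h.
Proof.
move=> gpos KL gh x u; apply: le_trans (gh x u) _.
by rewrite ler_wpM2r// positive_definite_ge0.
Qed.

(** The factor 2 is that between the logarithms of C and C^2. *)
Lemma rough_dist_quad_le D (g h : tensor_field A) : 1 < D ->
  continuous_metric g -> continuous_metric h ->
  (rough_dist g h < (ln D / 2)%:E)%E -> quad_le D g h.
Proof.
move=> D1 gc hc /rough_dist_lt[C [C1 CD gh]].
have C0 : 0 < C by rewrite (lt_le_trans _ C1).
have [+ _] := sim_quad_le C0 gc hc gh; apply: quad_leS; first by case: gc.
rewrite -ler_ln ?posrE ?exprn_gt0 ?(lt_trans _ D1)// lnXn//.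
by rewrite -mulr_natr -ler_pdivlMr// ltW.
Qed.

(** The limit is rough because it is within a factor 2 of a member of the
    sequence. *)
Lemma Met_C0_complete : complete_subset (Met_C0 A).
Proof.
move=> u uC0 ucauchy.
have /choice[g_ gP] : forall k, exists g : rough_metric A,
    continuous_metric g /\ \pi_(Met A) g = u k.
  by move=> k; have [g gc <-] := uC0 k; exists g.
have gc k : continuous_metric (g_ k) by have [] := gP k.
have dist_cauchy (e : R) : 0 < e -> exists N, forall k l, (N <= k)%N -> (N <= l)%N ->
    (rough_dist (g_ k) (g_ l) < e%:E)%E.
  move=> e0; have /cauchy_ballP/(_ e e0) := ucauchy.
  move=> [[P Q] /= [[N1 _ N1P] [N2 _ N2Q]] PQ].
  exists (maxn N1 N2) => k l; rewrite !geq_max => /andP[k1 _] /andP[_ l2].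
  have : Met_ball (u k) e (u l) by apply: (PQ (u k, u l)); split; [exact: N1P|exact: N2Q].
  by rewrite /Met_ball /= -(gP k).2 -(gP l).2 Met_distE.
have gcauchy D : 1 < D -> exists N, forall k l,
    (N <= k)%N -> (N <= l)%N -> quad_le D (g_ k) (g_ l).
  move=> D1; have e0 : 0 < ln D / 2 by rewrite divr_gt0// ln_gt0.
  have [N NP] := dist_cauchy _ e0; exists N => k l Nk Nl.
  by apply: rough_dist_quad_le => //; exact: NP.
pose g := limit_field gc gcauchy.
have gpos : positive_definite g := limit_field_positive gc gcauchy.
have gcont : continuous_field g by exact: limit_field_continuous.
have sim C : 1 < C -> exists N, forall k, (N <= k)%N -> sim_metric C (g_ k) g.
  move=> C1; have C0 : 0 < C by rewrite (lt_trans _ C1).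
  have C2 : 1 < C ^+ 2 by rewrite expr2 mulr_egt1.
  have [N NP] := limit_field_quad_le gc gcauchy C2; exists N => k Nk.
  by have [h1 h2] := NP k Nk; apply: quad_le_sim => //; have [] := gc k.
have grough : rough_metric_axiom g.
  have [N NP] := sim 2 (ltr1n _ _).
  apply: (sim_rough_metric _ (NP N (leqnn N))); first exact: ler1n.
    exact: continuous_measurable_field.
  exact: rough_metricP.
exists (\pi_(Met A) (RoughMetric grough)).
  by exists (RoughMetric grough).
apply/cvg_ballP => e e0.
have C1 : 1 < expR (e / 2) by rewrite expR_gt1 divr_gt0.
have [N NP] := sim _ C1; exists N => // k /= Nk.
suff : Met_ball (\pi_(Met A) (RoughMetric grough)) e (u k) by [].
rewrite /Met_ball /= -(gP k).2 Met_distE rough_dist_sym.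
apply: le_lt_trans (sim_rough_dist (ltW C1) (NP k Nk)) _.
by rewrite expRK lte_fin ltr_pdivrMr// ltr_pMr// ltr1n.
Qed.

(** A point of the closure is the limit of a sequence in the set, which also
    has a limit in the set; the two limits are at distance 0. *)
Lemma Met_C0_closed : closed (Met_C0 A).
Proof.
move=> G clG.
have /choice[u uP] : forall k : nat, exists H, Met_C0 A H /\ Met_ball G (k.+1%:R^-1) H.
  move=> k; have k0 : 0 < k.+1%:R^-1 :> R by [].
  have [H [H1 H2]] := clG _ (nbhsx_ballx G _ k0); by exists H.
have uG : u @ \oo --> G.
  apply/cvg_ballP => e e0.
  have := @cvg_harmonic R => /cvgr_lt/(_ e e0).
  apply: filterS => k ke; have [_] := uP k.
  by apply: (@le_ball _ (Met A)); exact: ltW.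
have uC : cauchy (u @ \oo).
  apply/cauchy_ballP => e e0; have e20 : 0 < e / 2 by rewrite divr_gt0.
  move/cvg_ballP : uG => /(_ _ e20) [N _ NP].
  exists (u @` [set k | (N <= k)%N], u @` [set k | (N <= k)%N]) => /=.
    by split; exists N => // k Nk; exists k.
  move=> [_ _] /= [[k Nk <-] [l Nl <-]]; rewrite (splitr e).
  by apply: ball_triangle (ball_sym (NP k Nk)) (NP l Nl).
have [L [h hcont <-] uL] := Met_C0_complete (fun k => (uP k).1) uC.
exists h => //.
have GE : \pi_(Met A) (repr G) = G by exact: reprK.
suff : ae_equal (repr G) h by move=> /eqmodP E; rewrite -E.
apply: rough_dist0_ae_equal; first by case: hcont.
rewrite -Met_distE GE; apply/eqP; rewrite eq_le; apply/andP; split; last first.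
  exact: rough_dist_ge0.
apply/lee_addgt0Pr => e e0; rewrite add0e.
have e20 : 0 < e / 2 by rewrite divr_gt0.
move/cvg_ballP : uG => /(_ _ e20) uG; move/cvg_ballP : uL => /(_ _ e20) uL.
have [k [Gk Lk]] : exists k, ball G (e / 2) (u k) /\ ball (\pi_(Met A) h) (e / 2) (u k).
  by near \oo => k; exists k; split; near: k.
have := ball_triangle Gk (ball_sym Lk); rewrite -splitr => H.
exact: ltW H.
Unshelve. all: by end_near. Qed.

End Complete.

(** * Smooth functions and smooth tensor fields *)

Section SmoothOn.
Context {R : realType} {V : normedModType R}.
Implicit Types (U : set V) (f g : V -> R).

Lemma smooth_on_cst U (a : R) : smooth_on U (fun _ : V => a).
Proof. by move=> k; exact: (Ck_on_cst k U a). Qed.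

Lemma smooth_onD U f g : open U -> smooth_on U f -> smooth_on U g ->
  smooth_on U (fun x => f x + g x).
Proof. by move=> oU fs gs k; exact: Ck_onD. Qed.

Lemma smooth_onM U f g : open U -> smooth_on U f -> smooth_on U g ->
  smooth_on U (fun x => f x * g x).
Proof. by move=> oU fs gs k; exact: Ck_onM. Qed.

Lemma smooth_on_sum U I (r : seq I) (f : I -> V -> R) : open U ->
  (forall i, smooth_on U (f i)) -> smooth_on U (fun x => \sum_(i <- r) f i x).
Proof.
move=> oU fs; elim: r => [|i r IH].
  by under eq_fun do rewrite big_nil; exact: smooth_on_cst.
by under eq_fun do rewrite big_cons; exact: smooth_onD.
Qed.

Lemma smooth_on_prod U I (r : seq I) (f : I -> V -> R) : open U ->
  (forall i, smooth_on U (f i)) -> smooth_on U (fun x => \prod_(i <- r) f i x).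
Proof.
move=> oU fs; elim: r => [|i r IH].
  by under eq_fun do rewrite big_nil; exact: smooth_on_cst.
by under eq_fun do rewrite big_cons; exact: smooth_onM.
Qed.

Lemma eq_smooth_on {W : normedModType R} U (f g : V -> W) : open U ->
  (forall x, U x -> f x = g x) -> smooth_on U f -> smooth_on U g.
Proof. by move=> oU fg fs k; exact: eq_Ck_on (fs k). Qed.

Lemma smooth_on_entry {n : nat} U (f : V -> 'rV[R]_n) i : open U ->
  smooth_on U f -> smooth_on U (fun x => f x ord0 i).
Proof.
move=> oU fs k.
have @L : {linear 'rV[R]_n -> R}.
  by exists (fun N : 'rV[R]_n => N ord0 i); do 2![eexists]; do ?[constructor];
     rewrite ?mxE// => ? *; rewrite ?mxE//; move=> ?; rewrite !mxE.
have cL : continuous L by exact: coord_continuous.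
exact: (Ck_on_linear_comp oU cL (fs k)).
Qed.

Lemma smooth_on_derive {W : normedModType R} U (f : V -> W) v :
  smooth_on U f -> smooth_on U ('D_v f).
Proof. by move=> fs k; have [_] := fs k.+1; apply. Qed.

End SmoothOn.

Section SmoothFields.
Context {R : realType} {n : nat} {M : topologicalType}.
Variable A : smooth_structure R n M.
Implicit Types (c d : chart R n M) (g h t : tensor_field A) (W K : set M).

Lemma open_fwd_image c W : open W -> open (fwd c @` (dom c `&` W)).
Proof.
move=> oW.
have -> : fwd c @` (dom c `&` W) = codom c `&` bwd c @^-1` W.
  apply/seteqP; split=> [_ [x [cx dx] <-]|_ [[x cx <-]]] /=.
    by split; [exists x|rewrite /= fwdK].
  by rewrite fwdK// => dx; exists x.
have oc := @open_codom _ _ _ c.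
have := @bwd_continuous _ _ _ c; rewrite continuous_open_subspace// continuous_inP//.
by apply.
Qed.

Lemma open_fwd_preimage c (U : set 'rV[R]_n) : open U -> open (dom c `&` fwd c @^-1` U).
Proof.
move=> oU; have oc := @open_dom _ _ _ c.
have := @fwd_continuous _ _ _ c; rewrite continuous_open_subspace// continuous_inP//.
by apply.
Qed.

Lemma smooth_on_cover d (f : 'rV[R]_n -> R) :
  (forall x, dom d x -> exists W, [/\ open W, W x &
     smooth_on (fwd d @` (dom d `&` W)) f]) -> smooth_on (codom d) f.
Proof.
move=> fW k; have /choice[W WP] : forall x, exists W, dom d x ->
    [/\ open W, W x & smooth_on (fwd d @` (dom d `&` W)) f].
  move=> x; have [/fW[W WP]|ndx] := pselect (dom d x); first by exists W.
  by exists set0.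
apply: (@Ck_onS _ _ _ _ _ (\bigcup_(x in dom d) (fwd d @` (dom d `&` W x)))).
  by move=> _ [x dx <-]; exists x => //; exists x => //; split=> //; have [] := WP x dx.
by apply: Ck_on_bigcup => x dx; have [_ _] := WP x dx; apply.
Qed.

(** Extension by zero: off dom c the function vanishes on the complement of K,
    which is open as K is closed. *)
Lemma smooth_on_extend d c K (f : 'rV[R]_n -> R) : closed K -> K `<=` dom c ->
  smooth_on (fwd d @` (dom d `&` dom c)) f ->
  (forall y, codom d y -> ~ K (bwd d y) -> f y = 0) -> smooth_on (codom d) f.
Proof.
move=> cK Kc fs f0; apply: smooth_on_cover => x dx.
have [cx|ncx] := pselect (dom c x).
  by exists (dom c); split=> //; exact: open_dom.
exists (~` K); split; [exact: closed_openC|by move=> /Kc|].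
apply: (@eq_smooth_on _ _ _ _ (fun=> 0)); last exact: smooth_on_cst.
  by apply: open_fwd_image; exact: closed_openC.
by move=> _ [z [dz Kz] <-]; rewrite f0 ?fwdK//; exists z.
Qed.

Definition smooth_fun (f : M -> R) : Prop :=
  forall c, atlas A c -> smooth_on (codom c) (f \o bwd c).

Definition smooth_field t : Prop :=
  forall c i j, atlas A c -> smooth_on (codom c) (component t c i j).

Lemma smooth_field_continuous t : smooth_field t -> continuous_field t.
Proof.
move=> ts c i j Ac; rewrite continuous_open_subspace; last exact: open_codom.
by move=> y /set_mem cy; have := ts c i j Ac 0; apply.
Qed.

Lemma smooth_field_local t :
  (forall x, exists W s, [/\ open W, W x, smooth_field s &
     forall y (u v : tangent A y), W y -> t y u v = s y u v]) -> smooth_field t.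
Proof.
move=> tloc c i j Ac; apply: smooth_on_cover => x cx.
have [W [s [oW Wx ss ts]]] := tloc x; exists W; split=> //.
apply: (@eq_smooth_on _ _ _ _ (component s c i j)).
- exact: open_fwd_image.
- by move=> _ [z [cz Wz] <-]; rewrite /component ts// fwdK.
move=> k; apply: Ck_onS (ss c i j Ac k).
by move=> _ [z [cz _] <-]; exists z.
Qed.

Definition zero_field : tensor_field A := fun x => @symmetric_form_of _ _
  (fun _ _ => 0) (fun _ _ => erefl) (fun a _ _ _ => esym (etrans (addr0 _) (mulr0 a))).

Let add_fieldP g h x a (u v w : tangent A x) :
  g x (a *: u + v) w + h x (a *: u + v) w =
  a * (g x u w + h x u w) + (g x v w + h x v w).
Proof. by rewrite !sym_formDl !sym_formZl mulrDr addrACA. Qed.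

Definition add_field g h : tensor_field A := fun x => @symmetric_form_of _ _
  (fun u v => g x u v + h x u v)
  (fun u v => congr2 +%R (sym_formC (g x) u v) (sym_formC (h x) u v)) (@add_fieldP g h x).

Let scale_fieldP (f : M -> R) h x a (u v w : tangent A x) :
  f x * h x (a *: u + v) w = a * (f x * h x u w) + f x * h x v w.
Proof. by rewrite !sym_formDl !sym_formZl mulrDr mulrCA. Qed.

Definition scale_field (f : M -> R) h : tensor_field A := fun x =>
  @symmetric_form_of _ _ (fun u v => f x * h x u v)
  (fun u v => congr1 ( *%R (f x)) (sym_formC (h x) u v)) (@scale_fieldP f h x).

Lemma smooth_zero_field : smooth_field zero_field.
Proof. by move=> c i j Ac; exact: smooth_on_cst. Qed.

Lemma smooth_add_field g h : smooth_field g -> smooth_field h ->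
  smooth_field (add_field g h).
Proof.
by move=> gs hs c i j Ac; apply: smooth_onD; [exact: open_codom|exact: gs|exact: hs].
Qed.

Lemma smooth_scale_field f h : smooth_fun f -> smooth_field h ->
  smooth_field (scale_field f h).
Proof.
by move=> fs hs c i j Ac; apply: smooth_onM; [exact: open_codom|exact: fs|exact: hs].
Qed.

End SmoothFields.

(** * Cutoff functions *)

Section Bump.
Context {R : realType} {n : nat}.
Implicit Types (a z : 'rV[R]_n) (r s : R).

Definition cube a r : set 'rV[R]_n := [set z | forall i, `|z ord0 i - a ord0 i| <= r].

(** A product of functions of one coordinate, so that composing it with a
    change of charts calls for [Ck_on_comp] only. It is 1 on the cube of radius
    s and 0 off the cube of radius 2 s, as the argument of [plateau] is
    nonpositive for |z_i - a_i| <= s and at least 3 for |z_i - a_i| >= 2 s. *)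
Definition cube_bump a s z : R :=
  \prod_i plateau (((z ord0 i - a ord0 i) / s) ^+ 2 - 1).

Lemma cube_bump_ge0 a s z : 0 <= cube_bump a s z.
Proof. by apply: prodr_ge0 => i _; exact: plateau_ge0. Qed.

Lemma cube_bump_le1 a s z : cube_bump a s z <= 1.
Proof. by apply: prodr_ile1 => i; rewrite plateau_ge0 plateau_le1. Qed.

Lemma cube_bump_eq1 a s z : 0 < s -> cube a s z -> cube_bump a s z = 1.
Proof.
move=> s0 az; apply: big1 => i _; apply: plateau_eq1.
rewrite subr_le0 -[X in X <= _]ger0_norm ?sqr_ge0// normrX normrM normfV (gtr0_norm s0).
by rewrite expr_le1// ?mulr_ge0 ?invr_ge0 ?(ltW s0)// ler_pdivrMr// mul1r.
Qed.

Lemma cube_bump_eq0 a s z : 0 < s -> ~ cube a (2 * s) z -> cube_bump a s z = 0.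
Proof.
move=> s0 /existsNP[i /negP]; rewrite -ltNge => zi.
rewrite /cube_bump (bigD1 i)//= plateau_eq0 ?mul0r// lerBrDr.
rewrite -[leRHS]ger0_norm ?sqr_ge0// normrX normrM normfV (gtr0_norm s0).
have : 2 <= `|z ord0 i - a ord0 i| / s by rewrite ler_pdivlMr// ltW.
by move=> h; rewrite expr2; nra.
Qed.

Lemma smooth_on_cube_bump {V : normedModType R} (U : set V) (f : V -> 'rV[R]_n) a s :
  open U -> smooth_on U f -> smooth_on U (fun x => cube_bump a s (f x)).
Proof.
move=> oU fs; apply: smooth_on_prod => // i k.
apply: (@Ck_on_comp _ _ _ _ plateau (fun x => ((f x ord0 i - a ord0 i) / s) ^+ 2 - 1)) => //.
  by move=> m; exact: Ck_on_plateau.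
suff : smooth_on U (fun x => ((f x ord0 i - a ord0 i) / s) ^+ 2 - 1) by apply.
have ls : smooth_on U (fun x => (f x ord0 i - a ord0 i) / s).
  apply: smooth_onM => //; last exact: smooth_on_cst.
  by apply: smooth_onD; [|exact: smooth_on_entry|exact: smooth_on_cst].
by apply: smooth_onD; [|exact: smooth_onM|exact: smooth_on_cst].
Qed.

Lemma compact_cube a r : compact (cube a r).
Proof.
rewrite (_ : cube a r = [set z | forall i,
    `[a ord0 i - r, a ord0 i + r]%classic (z ord0 i)]).
  apply: (@rV_compact _ _ (fun i => `[a ord0 i - r, a ord0 i + r]%classic)) => i.
  exact: segment_compact.
by apply/seteqP; split=> z az i; have := az i; rewrite /= in_itv/= ler_distl.
Qed.

Lemma cube_ball a (r : R) : 0 < r -> cube a (2 * (r / 3)) `<=` ball a r.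
Proof.
move=> r0 z az; split=> // i0 i; rewrite ord1 -ball_normE /= distrC.
by apply: le_lt_trans (az i) _; lra.
Qed.

Lemma cube_nbhs a s : 0 < s -> nbhs a (cube a s).
Proof.
move=> s0; apply: filterS (nbhsx_ballx a s s0) => z [_ az] i.
by have := az ord0 i; rewrite -ball_normE /= distrC => /ltW.
Qed.

End Bump.

Section ChartBump.
Context {R : realType} {n : nat} {M : topologicalType}.
Context {A : smooth_structure R n M}.
Hypothesis hausdorffM : hausdorff_space M.
Implicit Types (c d : chart R n M) (g h t : tensor_field A).

Lemma coord_tangent_of c d x v : chart_at A x c -> chart_at A x d ->
  coord d (tangent_of A c x v) = 'D_v (transition c d) (fwd c x).
Proof.
move=> cx dx; rewrite deriveE; last exact: transition_differentiable cx dx.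
by rewrite /coord /=; case: asboolP => // -[].
Qed.

Definition chart_bump c a (s : R) (x : M) : R :=
  if `[< dom c x >] then cube_bump a s (fwd c x) else 0.

Let in_chartP g c a y (u v w : 'rV[R]_n) :
  in_chart g c (a *: u + v) w y = a * in_chart g c u w y + in_chart g c v w y.
Proof. by rewrite /in_chart tangent_ofP sym_formDl sym_formZl. Qed.

(** The field whose matrix in the chart c is constant, equal to that of g at y.
    It is meaningful over dom c only, and gets multiplied by a cutoff. *)
Definition frozen_field g c (y : 'rV[R]_n) : tensor_field A := fun x =>
  @symmetric_form_of R (tangent A x) (fun u v => in_chart g c (coord c u) (coord c v) y)
  (fun u v => sym_formC (g (bwd c y)) _ _)
  (fun a u v w => in_chartP g c a y (coord c u) (coord c v) (coord c w)).

Variables (c : chart R n M) (a : 'rV[R]_n) (s : R).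
Hypotheses (Ac : atlas A c) (s0 : 0 < s) (ac : cube a (2 * s) `<=` codom c).

Definition bump_support : set M := bwd c @` cube a (2 * s).

(** This is where the separation of M enters: in a non-Hausdorff manifold the
    compact image of a cube may fail to be closed. *)
Lemma closed_bump_support : closed bump_support.
Proof.
apply: compact_closed => //; apply: continuous_compact (@compact_cube _ _ a _).
exact: continuous_subspaceW ac (@bwd_continuous _ _ _ c).
Qed.

Lemma bump_support_dom : bump_support `<=` dom c.
Proof. by move=> _ [z /ac/bwdK[]] + _ <-. Qed.

Lemma chart_bump_out x : ~ bump_support x -> chart_bump c a s x = 0.
Proof.
rewrite /chart_bump => nx; case: asboolP => // cx; apply: cube_bump_eq0 => // xa.
by apply: nx; exists (fwd c x) => //; rewrite fwdK.
Qed.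

Lemma smooth_chart_bump_overlap d : atlas A d ->
  smooth_on (fwd d @` (dom d `&` dom c)) (chart_bump c a s \o bwd d).
Proof.
move=> Ad; have oO := @open_overlap _ _ _ d c.
have [Ts _] := atlas_compatible Ad Ac.
apply: eq_smooth_on (smooth_on_cube_bump a s oO Ts) => // _ [x [dx cx] <-].
by rewrite /= /chart_bump /transition /= fwdK//; case: asboolP.
Qed.

Lemma smooth_chart_bump : smooth_fun A (chart_bump c a s).
Proof.
move=> d Ad; apply: (smooth_on_extend closed_bump_support bump_support_dom).
  exact: smooth_chart_bump_overlap.
by move=> y _ ny /=; exact: chart_bump_out.
Qed.

(** In another chart d the components of the frozen field are quadratic in the
    derivatives of the transition map from d to c, which are smooth. *)
Lemma smooth_bump_frozen g :
  smooth_field (scale_field (chart_bump c a s) (frozen_field g c a)).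
Proof.
move=> d i j Ad; have oO := @open_overlap _ _ _ d c.
have [Ts _] := atlas_compatible Ad Ac.
apply: (smooth_on_extend closed_bump_support bump_support_dom); last first.
  by move=> y dy ny; rewrite /component /= chart_bump_out// mul0r.
pose e i : 'rV[R]_n := delta_mx ord0 i.
pose T := transition d c.
have fs : smooth_on (fwd d @` (dom d `&` dom c)) (fun y => \sum_k \sum_l
    'D_(e i) T y ord0 k * 'D_(e j) T y ord0 l * component g c k l a).
  have De k l : smooth_on (fwd d @` (dom d `&` dom c)) (fun y => 'D_(e k) T y ord0 l).
    by apply: smooth_on_entry => //; exact: smooth_on_derive.
  apply: smooth_on_sum => // k; apply: smooth_on_sum => // l.
  apply: smooth_onM => //; last exact: smooth_on_cst.
  by apply: smooth_onM => //; exact: De.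
apply: eq_smooth_on (smooth_onM oO (smooth_chart_bump_overlap Ad) fs) => //.
move=> _ [x [dx cx] <-].
have E (y : M) : y = x ->
    \sum_k \sum_l ('D_(e i) T (fwd d x)) ord0 k * ('D_(e j) T (fwd d x)) ord0 l *
      component g c k l a =
    frozen_field g c a y (tangent_of A d y (e i)) (tangent_of A d y (e j)).
  move=> ->; rewrite /frozen_field symmetric_form_ofE.
  have xd : chart_at A x d by [].
  have xc : chart_at A x c by [].
  by rewrite !coord_tangent_of// in_chart_components.
by rewrite (E (bwd d (fwd d x)) (fwdK dx)).
Qed.

End ChartBump.

(** * Local models of a continuous metric *)

Section LocalModel.
Context {R : realType} {n : nat} {M : topologicalType}.
Context {A : smooth_structure R n M}.
Implicit Types (c d : chart R n M) (g h t : tensor_field A).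

Lemma sum_pairs_le (v : 'rV[R]_n) (m : 'I_n -> 'I_n -> R) (e : R) :
  (forall i j, `|m i j| <= e) ->
  `|\sum_i \sum_j v ord0 i * v ord0 j * m i j|
    <= e * (2 * n%:R * \sum_i v ord0 i ^+ 2).
Proof.
move=> me.
have -> : 2 * n%:R * \sum_i v ord0 i ^+ 2 =
    \sum_i \sum_j (v ord0 i ^+ 2 + v ord0 j ^+ 2).
  under [RHS]eq_bigr do rewrite big_split /= sumr_const card_ord.
  rewrite big_split /= sumr_const card_ord sumrMnl -[X in _ = X + _]mulr_natl.
  by rewrite -[X in _ = _ + X]mulr_natl; ring.
apply: le_trans (ler_norm_sum _ _ _) _; rewrite mulr_sumr; apply: ler_sum => i _.
apply: le_trans (ler_norm_sum _ _ _) _; rewrite mulr_sumr; apply: ler_sum => j _.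
rewrite normrM mulrC; apply: ler_pM => //.
rewrite normrM; have := sqr_ge0 (`|v ord0 i| - `|v ord0 j|).
rewrite -(real_normK (num_real (v ord0 i))) -(real_normK (num_real (v ord0 j))).
have := normr_ge0 (v ord0 i); have := normr_ge0 (v ord0 j).
by nra.
Qed.

(** A rough metric dominates the Euclidean one almost everywhere in some chart
    at each point; for a continuous metric this holds at every point. *)
Lemma euclidean_le c (K : R) g : atlas A c -> 1 <= K -> continuous_metric g ->
  almost_everywhere A (fun y => dom c y -> forall u : tangent A y,
      K^-1 * pullback_norm c u <= tnorm g u <= K * pullback_norm c u) ->
  forall (v : 'rV[R]_n) y, codom c y -> \sum_i v ord0 i ^+ 2 <= K ^+ 2 * in_chart g c v v y.
Proof.
move=> Ac K1 [gpos gc] gK v y cy.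
have K0 : 0 < K by rewrite (lt_le_trans _ K1).
pose f y := \sum_i v ord0 i ^+ 2 - K ^+ 2 * in_chart g c v v y.
suff : f y <= 0 by rewrite subr_le0.
apply: (ae_chart_le0 Ac) cy => [z cz|].
  exact: (cvgB (cvg_cst _) (cvgM (cvg_cst _) (in_chart_continuous gc Ac cz))).
apply: ae_and (gK) (gK) => x gKx _ cx.
have cAx : chart_at A x c by [].
have uE := tangent_ofK cAx v.
have gE := in_chart_fwd g (tangent_of A c x v) (tangent_of A c x v) cAx.
have /andP[+ _] := gKx cx (tangent_of A c x v).
rewrite ler_pdivrMl// /tnorm /pullback_norm sqrt_le_quad ?positive_definite_ge0//.
by rewrite -gE uE subr_le0.
Qed.

(** The components vary by at most e near a, and the Euclidean lower bound
    turns this additive error into a factor, uniformly in the vector v. *)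
Lemma frozen_close D c (a : 'rV[R]_n) (K : R) g : 1 < D -> atlas A c -> codom c a ->
  0 < K -> continuous_metric g ->
  (forall (v : 'rV[R]_n) y, codom c y -> \sum_i v ord0 i ^+ 2 <= K * in_chart g c v v y) ->
  \forall z \near a, codom c z /\ forall v,
    in_chart g c v v z <= D * in_chart g c v v a /\
    in_chart g c v v a <= D * in_chart g c v v z.
Proof.
move=> D1 Ac ca K0 [gpos gc] gK.
have L0 : 0 < 2 * n%:R * K + 1 by rewrite ltr_wpDl// mulr_ge0 ?(ltW K0)// mulr_ge0.
have [e e0 eL] : exists2 e, 0 < e & e * (2 * n%:R * K) <= D - 1.
  exists ((D - 1) / (2 * n%:R * K + 1)); first by rewrite divr_gt0// subr_gt0.
  by rewrite mulrAC ler_pdivrMr// ler_pM2l ?subr_gt0// lerDl.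
have near1 : nbhs a [set z | forall i j, `|component g c i j z - component g c i j a| <= e].
  apply: (@filter_forall _ _ _ (nbhs a)) => i.
  apply: (@filter_forall _ _ _ (nbhs a)) => j.
  have := gc c i j Ac; rewrite continuous_open_subspace; last exact: open_codom.
  move=> /(_ a (mem_set ca)) /cvgrPdist_le /(_ e e0).
  by apply: filterS => z; rewrite distrC.
have near2 : nbhs a (codom c) by apply: open_nbhs_nbhs; split=> //; exact: open_codom.
apply: filterS2 near1 near2 => z ze cz; split=> // v.
have := @sum_pairs_le v (fun i j => component g c i j z - component g c i j a) e ze.
have -> : \sum_i \sum_j v ord0 i * v ord0 j *
    (component g c i j z - component g c i j a) =
    in_chart g c v v z - in_chart g c v v a.
  rewrite !in_chart_components -sumrB; apply: eq_bigr => i _.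
  by rewrite -sumrB; apply: eq_bigr => j _; rewrite mulrBr.
have close y : codom c y -> e * (2 * n%:R * \sum_i v ord0 i ^+ 2) <=
    (D - 1) * in_chart g c v v y.
  move=> cy; apply: (@le_trans _ _ (e * (2 * n%:R * K) * in_chart g c v v y)).
    rewrite -!mulrA; apply: ler_wpM2l; first exact: ltW e0.
    by do 2 apply: ler_wpM2l => //; exact: gK.
  by rewrite ler_wpM2r// positive_definite_ge0.
have := close z cz; have := close a ca; rewrite ler_norml !mulrBl !mul1r.
by move=> h1 h2 /andP[h3 h4]; split; lra.
Qed.

(** A cutoff f that equals 1 on W, and a smooth field t that is within the
    factor D of f g. *)
Record model (D : R) g (W : set M) (f : M -> R) t : Prop := Model {
  model_ge0 : forall x, 0 <= f x;
  model_le1 : forall x, f x <= 1;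
  model_smooth_fun : smooth_fun A f;
  model_smooth : smooth_field t;
  model_le : forall x u, t x u u <= D * (f x * g x u u);
  model_ge : forall x u, f x * g x u u <= D * t x u u;
  model_open : open W;
  model_eq1 : forall x, W x -> f x = 1 }.

Lemma local_model D (g : rough_metric A) x0 : hausdorff_space M -> 1 < D ->
  continuous_metric g -> exists W f t, model D g W f t /\ W x0.
Proof.
move=> hM D1 gc; have [_ /(_ x0)[c [[Ac cx0] [K K1 gK]]]] := rough_metricP g.
have K0 : 0 < K by rewrite (lt_le_trans _ K1).
pose a := fwd c x0.
have ca : codom c a by exists x0.
have near1 := frozen_close D1 Ac ca (exprn_gt0 2 K0) gc (euclidean_le Ac K1 gc gK).
have /nbhs_ballP[r /= r0 rP] := near1.
(* the cube of radius 2 s lies in the ball of radius r *)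
pose s := r / 3; have s0 : 0 < s by rewrite divr_gt0.
have sP z : cube a (2 * s) z -> codom c z /\ forall v,
    in_chart g c v v z <= D * in_chart g c v v a /\
    in_chart g c v v a <= D * in_chart g c v v z.
  by move=> /(cube_ball r0); exact: rP.
have ac : cube a (2 * s) `<=` codom c by move=> z /sP[].
pose f := chart_bump c a s.
have f01 x : 0 <= f x <= 1.
  by rewrite /f /chart_bump; case: asboolP => _; rewrite ?cube_bump_ge0 ?cube_bump_le1 ?lexx ?ler01.
have key x (u : tangent A x) :
    f x * frozen_field g c a x u u <= D * (f x * rough_field g x u u) /\
    f x * rough_field g x u u <= D * (f x * frozen_field g c a x u u).
  have [Kx|nKx] := pselect (bump_support c a s x); last first.
    by rewrite /f chart_bump_out// !mul0r !mulr0.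
  have cx := bump_support_dom ac Kx.
  have cAx : chart_at A x c by [].
  have xa : cube a (2 * s) (fwd c x).
    by have [z za <-] := Kx; have [_ ->] := bwdK (ac _ za).
  have [_ /(_ (coord c u))[h1 h2]] := sP _ xa.
  rewrite (in_chart_fwd g u u cAx) in h1 h2.
  have f0 : 0 <= f x by case/andP: (f01 x).
  by rewrite !(mulrCA D); split; rewrite ler_wpM2l.
exists (dom c `&` fwd c @^-1` (cube a s)^°), f, (scale_field f (frozen_field g c a)).
split; last first.
  by split=> //; apply: (@cube_nbhs _ _ a s).
split.
- by move=> x; case/andP: (f01 x).
- by move=> x; case/andP: (f01 x).
- exact: smooth_chart_bump.
- exact: smooth_bump_frozen.
- by move=> x u; have [] := key x u.
- by move=> x u; have [] := key x u.
- by apply: open_fwd_preimage; exact: open_interior.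
- move=> x [cx /interior_subset xa]; rewrite /f /chart_bump.
  by case: asboolP => // _; exact: cube_bump_eq1.
Qed.

End LocalModel.

(** * Gluing local models *)

(** Lindelof's theorem for a cover indexed by the points. The sequence is
    [None] at the indices that number no basic open set inside a member of the
    cover; this also accounts for an empty space. *)
Lemma countable_subcover (T : topologicalType) (W : T -> set T) :
  @second_countable T -> (forall x, open (W x)) -> (forall x, W x x) ->
  exists s : nat -> option T, forall x, exists k y, s k = Some y /\ W y x.
Proof.
move=> [B /countable_injP[num numI] [_ Bx]] oW Wx.
have /choice[s sP] : forall k, exists o : option T, forall b, B b -> num b = k ->
    forall y, b `<=` W y -> exists2 z, o = Some z & b `<=` W z.
  move=> k; have [[b [y [Bb bk bW]]]|no] := pselect (exists b y, [/\ B b, num b = k & b `<=` W y]).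
    exists (Some y) => b' Bb' b'k z _; exists y => //.
    suff -> : b' = b by [].
    by apply: numI; [exact: mem_set|exact: mem_set|rewrite b'k bk].
  by exists None => b Bb bk y bW; case: no; exists b, y.
exists s => x.
have [b [Bb bx] bW] := Bx x (W x) (open_nbhs_nbhs (conj (oW x) (Wx x))).
by have [z sz bz] := sP _ b Bb erefl x bW; exists (num b), z; split=> //; exact: bz.
Qed.

Section Glue.
Context {R : realType} {n : nat} {M : topologicalType}.
Context {A : smooth_structure R n M}.
Variables (D : R) (g : tensor_field A).
Variables (W : nat -> set M) (f : nat -> M -> R) (t : nat -> tensor_field A).
Hypothesis D1 : 1 < D.
Hypothesis gpos : positive_definite g.
Hypothesis modelP : forall k, model D g (W k) (f k) (t k).
Hypothesis coverP : forall x, exists k, W k x.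

(** The weight that the first k cutoffs leave for the next ones, namely the
    product of the 1 - f j for j < k. *)
Fixpoint remainder k (x : M) : R :=
  if k is j.+1 then remainder j x * (1 - f j x) else 1.

Fixpoint partial_sum k : tensor_field A :=
  if k is j.+1 then add_field (partial_sum j) (scale_field (remainder j) (t j))
  else zero_field A.

Lemma remainder_ge0 k x : 0 <= remainder k x.
Proof.
elim: k => [|k IH] //=; rewrite mulr_ge0// subr_ge0.
exact: (model_le1 (modelP k)).
Qed.

Lemma smooth_remainder k : smooth_fun A (remainder k).
Proof.
move=> c Ac; have oc := @open_codom _ _ _ c.
elim: k => [|k IH] /=; first exact: smooth_on_cst.
apply: (smooth_onM oc IH).
apply: (eq_smooth_on (f := fun y => 1 + -1 * f k (bwd c y))) => //.
  by move=> y _; rewrite mulN1r.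
apply: (smooth_onD oc (smooth_on_cst _ _)).
apply: (smooth_onM oc (smooth_on_cst _ _)).
exact: (model_smooth_fun (modelP k)).
Qed.

Lemma smooth_partial_sum k : smooth_field (partial_sum k).
Proof.
elim: k => [|k IH] /=; first exact: smooth_zero_field.
apply: smooth_add_field => //; apply: smooth_scale_field.
  exact: smooth_remainder.
exact: (model_smooth (modelP k)).
Qed.

(** The weights used so far sum up to 1 - [remainder k]. *)
Lemma partial_sum_bounds k x u :
  partial_sum k x u u <= D * ((1 - remainder k x) * g x u u) /\
  (1 - remainder k x) * g x u u <= D * partial_sum k x u u.
Proof.
elim: k => [|k [IH1 IH2]] /=; first by rewrite subrr !mul0r mulr0.
have h1 := ler_wpM2l (remainder_ge0 k x) (model_le (modelP k) u).
have h2 := ler_wpM2l (remainder_ge0 k x) (model_ge (modelP k) u).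
by split; nra.
Qed.

Lemma remainder_eq0 k m x : W k x -> (k < m)%N -> remainder m x = 0.
Proof.
move=> Wx; elim: m => // m IH; rewrite ltnS leq_eqVlt => /predU1P[<-|km] /=.
  by rewrite (model_eq1 (modelP k))// subrr mulr0.
by rewrite IH// mul0r.
Qed.

(** Once the cutoff f k equals 1, later terms have weight 0: the sum is locally
    finite on the cover by the W k. *)
Lemma partial_sum_stable k m x u v : W k x -> (k < m)%N ->
  partial_sum m x u v = partial_sum k.+1 x u v.
Proof.
move=> Wx; elim: m => // m IH; rewrite ltnS leq_eqVlt => /predU1P[<-//|km].
rewrite -IH// [LHS]/=; rewrite (remainder_eq0 Wx km) mul0r addr0 //.
Qed.

(** Near a point of W k the glued field is the partial sum of order k + 1,
    which is smooth, and there the weights sum up to 1. *)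
Lemma glue_smooth : exists h : tensor_field A,
  [/\ smooth_metric h, quad_le D g h & quad_le D h g].
Proof.
have /choice[N WN] := coverP.
pose h : tensor_field A := fun x => partial_sum (N x).+1 x.
have hP x u : h x u u <= D * g x u u /\ g x u u <= D * h x u u.
  have := partial_sum_bounds (N x).+1 u.
  by rewrite (remainder_eq0 (WN x) (ltnSn _)) subr0 mul1r.
exists h; split; last 2 first.
- by move=> x u; have [] := hP x u.
- by move=> x u; have [] := hP x u.
split.
  move=> x u u0; have [_] := hP x u; have := gpos u0.
  by move=> gu /(lt_le_trans gu); rewrite pmulr_rgt0// (lt_trans _ D1).
apply: smooth_field_local => x; exists (W (N x)), (partial_sum (N x).+1); split.
- exact: (model_open (modelP _)).
- exact: WN.
- exact: smooth_partial_sum.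
move=> y u v Wy; rewrite /h.
rewrite -(@partial_sum_stable (N y) (maxn (N x) (N y)).+1) ?ltnS ?leq_maxr//.
by rewrite -(@partial_sum_stable (N x) (maxn (N x) (N y)).+1) ?ltnS ?leq_maxl.
Qed.

End Glue.

(** * Density of the smooth metrics *)

Section Density.
Context {R : realType} {n : nat} {M : topologicalType}.
Variable A : smooth_structure R n M.
Hypothesis hausdorffM : hausdorff_space M.
Hypothesis countableM : @second_countable M.

Lemma zero_model (D : R) (g : tensor_field A) :
  model D g set0 (fun=> 0) (zero_field A).
Proof.
split=> //.
- by move=> c _; exact: smooth_on_cst.
- exact: smooth_zero_field.
- by move=> x u; rewrite mul0r mulr0.
- by move=> x u; rewrite mul0r mulr0.
- exact: open0.
Qed.

Lemma smooth_approximation (D : R) (g : rough_metric A) : 1 < D ->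
  continuous_metric g -> exists h : tensor_field A,
  [/\ smooth_metric h, quad_le D g h & quad_le D h g].
Proof.
move=> D1 gc.
pose P (x : M) (m : set M * (M -> R) * tensor_field A) :=
  model D g m.1.1 m.1.2 m.2 /\ m.1.1 x.
have /choice[m mP] : forall x, exists m, P x m.
  by move=> x; have [W [f [t Wft]]] := local_model x hausdorffM D1 gc; exists (W, f, t).
have [s sP] : exists s : nat -> option M, forall x, exists k y,
    s k = Some y /\ (m y).1.1 x.
  apply: countable_subcover => // x; last by have [] := mP x.
  by have [mx _] := mP x; exact: (model_open mx).
pose m' k := if s k is Some y then m y else (set0, (fun=> 0), zero_field A).
apply: (@glue_smooth _ _ _ A D g (fun k => (m' k).1.1) (fun k => (m' k).1.2)
  (fun k => (m' k).2)) => //.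
- by case: gc.
- move=> k; rewrite /m'; case: (s k) => [y|]; last exact: zero_model.
  by have [] := mP y.
- by move=> x; have [k [y [sk Wx]]] := sP x; exists k; rewrite /m' sk.
Qed.

Lemma smooth_metric_continuous (h : tensor_field A) :
  smooth_metric h -> continuous_metric h.
Proof. by move=> [hpos hs]; split=> //; exact: smooth_field_continuous. Qed.

Lemma Met_smooth_sub : Met_smooth A `<=` Met_C0 A.
Proof. by move=> _ [h hs <-]; exists h => //; exact: smooth_metric_continuous. Qed.

Lemma Met_C0_sub_closure : Met_C0 A `<=` closure (Met_smooth A).
Proof.
move=> _ [g gc <-] B /nbhs_ballP[e /= e0 eB].
(* any factor C with 0 < ln C < e will do *)
have C1 : 1 < expR (e / 2) by rewrite expR_gt1 divr_gt0.
have D1 : 1 < expR (e / 2) ^+ 2 by rewrite expr2 mulr_egt1.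
have [h [hs gh hg]] := smooth_approximation D1 gc.
have hc := smooth_metric_continuous hs.
have sim : sim_metric (expR (e / 2)) g h.
  by apply: quad_le_sim => //; rewrite ?expR_gt0//; [case: gc|case: hc].
have hrough : rough_metric_axiom h.
  apply: (sim_rough_metric (ltW C1) sim); last exact: rough_metricP.
  by apply: continuous_measurable_field; case: hc.
exists (\pi_(Met A) (RoughMetric hrough)); split; first by exists (RoughMetric hrough).
apply: eB; suff : Met_ball (\pi_(Met A) g) e (\pi_(Met A) (RoughMetric hrough)) by [].
rewrite /Met_ball /= Met_distE; apply: le_lt_trans (sim_rough_dist (ltW C1) sim) _.
by rewrite expRK lte_fin ltr_pdivrMr// ltr_pMr// ltr1n.
Qed.

End Density.

Theorem theorem2p5 (R : realType) (n : nat) (M : topologicalType)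
    (A : smooth_structure R n M) (hausdorffM : hausdorff_space M)
    (countableM : @second_countable M) (connectedM : connected [set: M]) :
  [/\ closure (Met_smooth A) = Met_C0 A,
      closed (Met_C0 A) &
      complete_subset (Met_C0 A)].
Proof.
split; [|exact: Met_C0_closed|exact: Met_C0_complete].
apply/seteqP; split; last exact: Met_C0_sub_closure.
rewrite [X in _ `<=` X](closure_id _).1; last exact: Met_C0_closed.
by apply: closureS; exact: Met_smooth_sub.
Qed.
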